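(* Let $(A,\alpha)$ be a $C^*$-dynamical system and let $J$ be an ideal in $A$. Then there exists a faithful $J$-covariant representation of $(A,\alpha)$ if and only if $\ker\alpha\cap J=\{0\}$.
   Context: A $C^*$-dynamical system is a pair $(A,\alpha)$ where $A$ is a unital $C^*$-algebra and $\alpha:A\to A$ is a $*$-endomorphism (not assumed unital or injective). ''Ideal'' means closed two-sided ideal. A representation of $(A,\alpha)$ is a triple $(\pi,U,H)$ consisting of a unital $*$-representation $\pi:A\to L(H)$ on a Hilbert space $H$ and an operator $U\in L(H)$ with $U\pi(a)U^*=\pi(\alpha(a))$ for all $a\in A$ (in particular $U$ is a partial isometry). It is faithful if $\pi$ is injective. For an ideal $J$ in $A$, the representation is called $J$-covariant if $J=\{a\in A: U^*U\pi(a)=\pi(a)\}$. *)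

(* Defs.v *)
From HB Require Import structures.
From mathcomp Require Import all_boot all_order all_algebra.
From mathcomp Require Import sesquilinear complex ring lra.
From mathcomp Require Import boolp classical_sets functions reals topology.
From mathcomp Require Import normedtype.

Set Implicit Arguments.
Unset Strict Implicit.
Unset Printing Implicit Defensive.

Import Order.TTheory GRing.Theory Num.Theory ComplexField.
Import numFieldNormedType.Exports.

Local Open Scope classical_set_scope.
Local Open Scope complex_scope.
Local Open Scope ring_scope.

(* Norms are R[i]-valued; `0 <= _` in R[i] forces them to be real.
   The product is a field of the mixin since HB rejects a join of normed modules
   and rings that [numDomainType] does not inherit from; the ring structure is
   derived below. It is a [pzRingType] so that the zero algebra is a C*-algebra. *)
HB.mixin Record isCStarAlgebra (R : realType) A
    of CompleteNormedModule R[i] A := {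
  cstar_one : A;
  cstar_mul : A -> A -> A;
  star : A -> A;
  cstar_mulA : associative cstar_mul;
  cstar_mul1x : left_id cstar_one cstar_mul;
  cstar_mulx1 : right_id cstar_one cstar_mul;
  cstar_mulDl : left_distributive cstar_mul +%R;
  cstar_mulDr : right_distributive cstar_mul +%R;
  cstar_scaleAl : forall (k : R[i]) (x y : A),
    k *: cstar_mul x y = cstar_mul (k *: x) y;
  cstar_scaleAr : forall (k : R[i]) (x y : A),
    k *: cstar_mul x y = cstar_mul x (k *: y);
  cstar_mul_norm : forall x y : A, `|cstar_mul x y| <= `|x| * `|y|;
  starD : {morph star : x y / x + y};
  starZ : forall (k : R[i]) (x : A), star (k *: x) = k^* *: star x;
  cstar_mul_star : forall x y : A,
    star (cstar_mul x y) = cstar_mul (star y) (star x);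
  starK : involutive star;
  cstar_mul_starx : forall x : A, `|cstar_mul (star x) x| = `|x| ^+ 2 }.

#[short(type="cstarAlgType")]
HB.structure Definition CStarAlgebra (R : realType) :=
  {A of CompleteNormedModule R[i] A & isCStarAlgebra R A}.

HB.instance Definition _ (R : realType) (A : cstarAlgType R) :=
  GRing.Zmodule_isPzRing.Build A
    (@cstar_mulA _ A) (@cstar_mul1x _ A) (@cstar_mulx1 _ A)
    (@cstar_mulDl _ A) (@cstar_mulDr _ A).

Section CStarAlgebraTheory.
Variables (R : realType) (A : cstarAlgType R).
Implicit Types (k : R[i]) (x y : A).

Lemma cstar_scalerAl k x y : k *: (x * y) = (k *: x) * y.
Proof. exact: cstar_scaleAl. Qed.

Lemma cstar_scalerAr k x y : k *: (x * y) = x * (k *: y).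
Proof. exact: cstar_scaleAr. Qed.

Lemma cstar_normM x y : `|x * y| <= `|x| * `|y|.
Proof. exact: cstar_mul_norm. Qed.

Lemma starM x y : star (x * y) = star y * star x.
Proof. exact: cstar_mul_star. Qed.

Lemma cstar_norm x : `|star x * x| = `|x| ^+ 2.
Proof. exact: cstar_mul_starx. Qed.

End CStarAlgebraTheory.

(* [inner] is linear in its first argument. *)
HB.mixin Record isHilbert (R : realType) H of CompleteNormedModule R[i] H := {
  inner : {dot H for @Num.conj R[i]};
  inner_norm : forall x : H, inner x x = `|x| ^+ 2 }.

#[short(type="hilbertType")]
HB.structure Definition Hilbert (R : realType) :=
  {H of CompleteNormedModule R[i] H & isHilbert R H}.

Section BoundedOperators.
Context {R : realType}.
Implicit Type H : hilbertType R.

Definition bounded_operator {H} : {pred H -> H} :=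
  [pred f : H -> H | `[< linear f /\
     exists M : R[i], forall x, `|f x| <= M * `|x| >]].

(* [bop H] is L(H), with composition as product. *)
Record bop H := Bop {
  bop_fun :> H -> H;
  bop_funP : bop_fun \in bounded_operator }.

HB.instance Definition _ H := [isSub for @bop_fun H].
HB.instance Definition _ H := [Choice of bop H by <:].

Lemma bop_ext H (S T : bop H) : S =1 T -> S = T.
Proof. by move=> /funext/val_inj. Qed.

Lemma bop_linear H (T : bop H) : linear T.
Proof. by have /asboolP[] := bop_funP T. Qed.

HB.instance Definition _ H (T : bop H) :=
  GRing.isLinear.Build R[i] H H _ T (bop_linear T).

Lemma bop_bound H (T : bop H) :
  exists2 M : R[i], 0 <= M & forall x, `|T x| <= M * `|x|.
Proof.
have /asboolP[_ [M fM]] := bop_funP T; exists `|M| => // x.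
apply: (le_trans (fM x)).
have [->|x0] := eqVneq x 0; first by rewrite normr0 !mulr0.
have nx : 0 < `|x| by rewrite normr_gt0.
suff M0 : 0 <= M by rewrite ger0_norm.
by have := le_trans (normr_ge0 _) (fM x); rewrite pmulr_lge0.
Qed.

Lemma bounded_operator_submod H : submod_closed (@bounded_operator H).
Proof.
split=> [|k f g /asboolP[fl [M fM]] /asboolP[gl [N gN]]]; apply/asboolP; split.
- by move=> a x y; rewrite scaler0 addr0.
- by exists 0 => x; rewrite normr0 mul0r.
- move=> a x y; rewrite !fctE fl gl !scalerDr !scalerA (mulrC k).
  by rewrite addrACA.
- exists (`|k| * M + N) => x; rewrite !fctE.
  rewrite (le_trans (ler_normD _ _))// mulrDl lerD//.
  by rewrite normrZ -mulrA ler_wpM2l.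
Qed.

HB.instance Definition _ H :=
  GRing.isSubmodClosed.Build R[i] (H -> H) bounded_operator
    (bounded_operator_submod H).
HB.instance Definition _ H := [SubChoice_isSubLmodule of bop H by <:].

Lemma bop_id_subproof H : (id : H -> H) \in bounded_operator.
Proof. by apply/asboolP; split => //; exists 1 => x; rewrite mul1r. Qed.
Definition bop_id H : bop H := Bop (bop_id_subproof H).

Lemma bop_comp_subproof H (S T : bop H) : S \o T \in bounded_operator.
Proof.
apply/asboolP; split => [k x y /=|]; first by rewrite !linearP.
have [M M0 SM] := bop_bound S; have [N _ TN] := bop_bound T.
exists (M * N) => x /=; rewrite (le_trans (SM _))// -mulrA ler_wpM2l//.
Qed.
Definition bop_comp H (S T : bop H) : bop H := Bop (bop_comp_subproof S T).

Fact bop_compA H : associative (@bop_comp H).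
Proof. by move=> S T U; apply/bop_ext. Qed.
Fact bop_comp1x H : left_id (bop_id H) (@bop_comp H).
Proof. by move=> S; apply/bop_ext. Qed.
Fact bop_compx1 H : right_id (bop_id H) (@bop_comp H).
Proof. by move=> S; apply/bop_ext. Qed.
Fact bop_compDl H : left_distributive (@bop_comp H) +%R.
Proof. by move=> S T U; apply/bop_ext. Qed.
Fact bop_compDr H : right_distributive (@bop_comp H) +%R.
Proof. by move=> S T U; apply/bop_ext => x; rewrite /= !fctE linearD. Qed.

HB.instance Definition _ H := GRing.Zmodule_isPzRing.Build (bop H)
  (@bop_compA H) (@bop_comp1x H) (@bop_compx1 H)
  (@bop_compDl H) (@bop_compDr H).

Lemma bopME H (S T : bop H) x : (S * T) x = S (T x).
Proof. by []. Qed.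
Lemma bop1E H (x : H) : (1 : bop H) x = x.
Proof. by []. Qed.
Lemma bopDE H (S T : bop H) x : (S + T) x = S x + T x.
Proof. by []. Qed.
Lemma bopZE H (k : R[i]) (T : bop H) x : (k *: T) x = k *: T x.
Proof. by []. Qed.
End BoundedOperators.

Section Riesz.
Context {R : realType} {H : hilbertType R}.
Implicit Types (x y z : H) (c : R[i]).
Local Notation "''[' x , y ]" := (inner x y).

Lemma innerC x y : '[x, y] = ('[y, x])^*.
Proof. by rewrite (hermC (inner : {dot H for Num.conj}) x y) expr0 mul1r. Qed.
Lemma innerDl x y z : '[x + y, z] = '[x, z] + '[y, z].
Proof. exact: linearDl. Qed.
Lemma innerDr x y z : '[x, y + z] = '[x, y] + '[x, z].
Proof. exact: linearDr. Qed.
Lemma innerZl c x y : '[c *: x, y] = c * '[x, y].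
Proof. exact: linearZl_LR. Qed.
Lemma innerZr c x y : '[x, c *: y] = c^* * '[x, y].
Proof. exact: linearZr_LR. Qed.
Lemma innerNl x y : '[- x, y] = - '[x, y].
Proof. exact: linearNl. Qed.
Lemma innerNr x y : '[x, - y] = - '[x, y].
Proof. exact: linearNr. Qed.

Lemma inner_ext x y : (forall z, '[z, x] = '[z, y]) -> x = y.
Proof.
move=> xy; apply/eqP; rewrite -subr_eq0 -normr_eq0 -sqrf_eq0 -inner_norm.
by rewrite innerDr innerNr xy subrr.
Qed.

Lemma parallelogram x y :
  `|x - y| ^+ 2 = `|x| ^+ 2 *+ 2 + `|y| ^+ 2 *+ 2 - `|x + y| ^+ 2.
Proof.
rewrite -!inner_norm !innerDl !innerDr !innerNl !innerNr !mulr2n.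
ring.
Qed.

Lemma inner_eq0_of_min x y :
  (forall c, `|x| ^+ 2 <= `|x - c *: y| ^+ 2) -> '[x, y] = 0.
Proof.
move=> xmin; apply/eqP; rewrite -normr_eq0 -sqrf_eq0.
set b := '[x, y]; set s := (`|y| ^+ 2 + 1)^-1.
have y1 : 0 < `|y| ^+ 2 + 1 by rewrite ltr_wpDl// exprn_ge0.
have s0 : 0 < s by rewrite invr_gt0.
have sr : s^* = s by apply/CrealP/gtr0_real.
have /(_ (s * b)) := xmin.
rewrite -!inner_norm !innerDl !innerDr !innerNl !innerNr !innerZl !innerZr.
rewrite rmorphM /= sr (innerC y x) -/b !inner_norm.
rewrite -subr_ge0.
set t := (X in 0 <= X).
have -> : t = `|b| ^+ 2 * s * (s * `|y| ^+ 2 - 2).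
  rewrite /t normCK; ring.
rewrite -/b; apply: contraTT => b0.
have bs : 0 < `|b| ^+ 2 * s by rewrite mulr_gt0// exprn_gt0// normr_gt0; rewrite sqrf_eq0 normr_eq0 in b0.
apply/negP; rewrite pmulr_rge0// subr_ge0 => h.
have : s * `|y| ^+ 2 < 1 by rewrite mulrC ltr_pdivrMr// mul1r ltrDl.
by move=> /(le_lt_trans h); rewrite ltrn1.
Qed.

Section RieszRepresentation.
Variables (f : H -> R[i]) (M : R[i]).
Hypothesis flin : forall c x y, f (c *: x + y) = c * f x + f y.
Hypothesis M0 : 0 <= M.
Hypothesis fM : forall x, `|f x| <= M * `|x|.

Let N x : R := complex.Re (`|x| ^+ 2).
Let NE x : (N x)%:C = `|x| ^+ 2.
Proof. by rewrite /N RRe_real// realX// normr_real. Qed.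

Let f0 : f 0 = 0.
Proof. by have := flin (-1) 0 0; rewrite scaler0 addr0 mulN1r addNr. Qed.
Let fZ c x : f (c *: x) = c * f x.
Proof. by rewrite -[c *: x]addr0 flin f0 addr0. Qed.
Let fD x y : f (x + y) = f x + f y.
Proof. by rewrite -[x]scale1r flin mul1r scale1r. Qed.
Let fB x y : f (x - y) = f x - f y.
Proof. by rewrite fD -scaleN1r fZ mulN1r. Qed.

Lemma riesz_min x0 : f x0 = 1 ->
  exists2 w, f w = 1 & forall x, f x = 1 -> `|w| ^+ 2 <= `|x| ^+ 2.
Proof.
move=> fx0.
pose D := [set N x | x in [set x | f x = 1]].
have N0 x : 0 <= N x by rewrite -ler0c NE exprn_ge0.
have Dinf : has_inf D.
  split; first by exists (N x0); exists x0.
  by exists 0 => _ [x _ <-].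
pose d := inf D.
have dmin x : f x = 1 -> d <= N x.
  by move=> fx; apply: ge_inf; [exact: Dinf.2|exists x].
pose B (e : R) := [set x : H | f x = 1 /\ N x < d + e].
pose F := filter_from [set e : R | 0 < e] B.
have FF : ProperFilter F.
  apply: filter_from_proper => [|e e0].
    apply: filter_from_filter; first by exists 1 => /=.
    move=> i j i0 j0; exists (Num.min i j); first by rewrite /= lt_min i0.
    move=> x [fx Nx]; split; split => //; apply: (lt_le_trans Nx).
      by rewrite lerD2l ge_min lexx.
    by rewrite lerD2l ge_min lexx orbT.
  have [_ [x fx <-] xe] := inf_adherent e0 Dinf.
  by exists x.
have Fcauchy : cauchy F.
  apply/cauchy_exP => e e0.
  have eE : (complex.Re e)%:C = e :> R[i] by rewrite RRe_real// gtr0_real.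
  set r := complex.Re e in eE.
  have r0 : 0 < r by rewrite -ltcR eE.
  have r2 : 0 < r ^+ 2 / 4 by rewrite divr_gt0// exprn_gt0.
  have FB : F (B (r ^+ 2 / 4)) by exists (r ^+ 2 / 4).
  have [x [fx Nx]] := filter_ex FB.
  exists x; exists (r ^+ 2 / 4) => //= y [fy Ny].
  rewrite -ball_normE /=.
  rewrite -(ltr_pXn2r (n := 2)) ?nnegrE ?(ltW e0)//.
  rewrite -eE -(rmorphXn (real_complex R)) /= -NE ltcR.
  have : (N (x - y))%:C = (N x *+ 2 + N y *+ 2 - N (x + y))%:C.
    by rewrite !(rmorphD, rmorphN, rmorphMn) /= !NE parallelogram.
  move=> /complexI ->.
  have fxy : f (2^-1 *: (x + y)) = 1.
    by rewrite fZ fD fx fy mulVf// pnatr_eq0.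
  have := dmin _ fxy.
  have -> : N (2^-1 *: (x + y)) = 4^-1 * N (x + y).
    apply: complexI; rewrite rmorphM /= !NE normrZ exprMn; congr (_ * _).
    by rewrite normfV normr_nat fmorphV rmorph_nat exprVn -natrX.
  rewrite !mulr2n; lra.
have /cvg_ex[w Fw] : cvg F by exact: cauchy_cvg.
have near_w (e : R) (e' : R[i]) : 0 < e -> 0 < e' ->
    exists x, [/\ f x = 1, N x < d + e & `|w - x| < e'].
  move=> e0 e'0.
  have : F (ball w e' `&` B e).
    by apply: filterI; [exact: Fw (nbhsx_ballx _ _ e'0)|exists e].
  by move=> /filter_ex[x []]; rewrite -ball_normE /= => ? [? ?]; exists x.
exists w => [|y fy].
  apply/eqP; rewrite -subr_eq0 -normr_le0; apply/negPn/negP => k0.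
  have {}k0 : 0 < `|f w - 1| by rewrite normr_gt0; move: k0; rewrite normr_le0.
  have M1 : 0 < M + 1 by rewrite ltr_wpDl.
  have [x [fx _]] := near_w 1 _ ltr01 (divr_gt0 k0 M1).
  rewrite ltr_pdivlMr// => h.
  have := fM (w - x); rewrite fB fx => /(lt_le_trans h).
  by rewrite mulrDr mulr1 mulrC gtrDl normr_lt0.
rewrite real_leNgt ?realX ?normr_real//; apply/negP.
rewrite ltr_pXn2r ?nnegrE// => yw.
have a0 : 0 < (`|w| - `|y|) / 2 by rewrite divr_gt0// subr_gt0.
set m := (`|y| + `|w|) / 2.
have my : `|y| < m by rewrite (midf_lt yw).
have mE : (complex.Re m)%:C = m by rewrite RRe_real// ger0_real// (le_trans _ (ltW my)).
have b0 : 0 < (complex.Re m) ^+ 2 - N y.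
  by rewrite subr_gt0 -ltcR (rmorphXn (real_complex R)) /= mE NE ltr_pXn2r ?nnegrE// (le_trans _ (ltW my)).
have [x [fx Nx wx]] := near_w _ _ b0 a0.
have xm : `|x| < m.
  rewrite -(ltr_pXn2r (n := 2)) ?nnegrE//; last exact: (le_trans _ (ltW my)).
  rewrite -mE -(rmorphXn (real_complex R)) /= -NE ltcR (lt_le_trans Nx)//.
  by rewrite addrCA gerDl subr_le0 dmin.
have := le_lt_trans (ler_normD (w - x) x) (ltrD wx xm).
have -> : (`|w| - `|y|) / 2 + m = `|w| by rewrite /m; field.
by rewrite subrK ltxx.
Qed.

Lemma riesz : exists z, forall x, f x = '[x, z].
Proof.
have [[x0 fx0]|nf] := pselect (exists x, f x != 0); last first.
  exists 0 => x; rewrite linear0r; apply/eqP/negPn/negP => fx.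
  by apply: nf; exists x.
have [|w fw wmin] := @riesz_min ((f x0)^-1 *: x0); first by rewrite fZ mulVf.
have w0 : `|w| ^+ 2 != 0.
  rewrite sqrf_eq0 normr_eq0; apply/eqP => w0.
  by move: fw; rewrite w0 f0 => /eqP; rewrite eq_sym oner_eq0.
exists ((`|w| ^+ 2)^-1 *: w) => x.
rewrite innerZr.
have -> : ((`|w| ^+ 2)^-1)^* = (`|w| ^+ 2)^-1.
  by apply/CrealP; rewrite realV realX// normr_real.
have : '[w, x - f x *: w] = 0.
  apply: inner_eq0_of_min => c; apply: wmin.
  by rewrite fB fZ fB fZ fw mulr1 subrr mulr0 subr0.
rewrite innerC => /eqP; rewrite conjC_eq0 innerDl innerNl innerZl inner_norm.
by rewrite subr_eq0 => /eqP ->; rewrite mulrC mulfK.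
Qed.
End RieszRepresentation.
End Riesz.

Section Adjoint.
Context {R : realType} {H : hilbertType R}.
Implicit Types (x y z : H) (S T : bop H).
Local Notation "''[' x , y ]" := (inner x y).

Lemma cauchy_schwarz x y : `|'[x, y]| <= `|x| * `|y|.
Proof.
have [->|y0] := eqVneq y 0; first by rewrite linear0r !normr0 mulr0.
have y2 : 0 < `|y| ^+ 2 by rewrite exprn_gt0// normr_gt0.
set b := '[x, y]; set s := (`|y| ^+ 2)^-1.
have sy : s * `|y| ^+ 2 = 1 by rewrite mulVf// gt_eqF.
have sr : s^* = s by apply/CrealP; rewrite realV realX// normr_real.
have : 0 <= `|x - (s * b) *: y| ^+ 2 by rewrite exprn_ge0.
rewrite -!inner_norm !innerDl !innerDr !innerNl !innerNr !innerZl !innerZr.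
rewrite rmorphM /= sr (innerC y x) -/b !inner_norm.
set t := (X in 0 <= X).
have -> : t = `|x| ^+ 2 - s * `|b| ^+ 2 + (s * `|y| ^+ 2 - 1) * s * `|b| ^+ 2.
  by rewrite /t normCK; ring.
rewrite sy subrr !mul0r addr0 subr_ge0 /s mulrC ler_pdivrMr// -exprMn.
by rewrite ler_pXn2r ?nnegrE ?mulr_ge0 // => /le_trans; apply.
Qed.

Lemma adjoint_subproof T y : exists z, forall x, '[T x, y] = '[x, z].
Proof.
have [M M0 TM] := bop_bound T.
apply: (@riesz _ _ (fun x => '[T x, y]) (M * `|y|)).
- by move=> c u v; rewrite linearP innerDl innerZl.
- by rewrite mulr_ge0.
- move=> x; rewrite (le_trans (cauchy_schwarz _ _))// mulrAC.
  by rewrite ler_wpM2r.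
Qed.

Let adjoint_fun T y : H := projT1 (cid (adjoint_subproof T y)).

Let adjoint_funE T x y : '[T x, y] = '[x, adjoint_fun T y].
Proof. by rewrite /adjoint_fun; case: cid => z /= ->. Qed.

Fact adjoint_fun_bounded T : adjoint_fun T \in bounded_operator.
Proof.
apply/asboolP; split => [c x y|].
  apply: inner_ext => z.
  by rewrite -adjoint_funE innerDr innerZr !adjoint_funE innerDr innerZr.
have [M M0 TM] := bop_bound T; exists M => y.
set z := adjoint_fun T y.
have [->|z0] := eqVneq z 0; first by rewrite normr0 mulr_ge0.
have nz : 0 < `|z| by rewrite normr_gt0.
rewrite -(ler_pM2l nz) -expr2 -inner_norm -adjoint_funE.
rewrite -[leLHS]ger0_norm; last by rewrite adjoint_funE inner_norm exprn_ge0.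
by rewrite (le_trans (cauchy_schwarz _ _))// mulrA (mulrC _ M) ler_wpM2r.
Qed.

Definition adjoint T : bop H := Bop (adjoint_fun_bounded T).

Lemma adjointP T x y : '[T x, y] = '[x, adjoint T y].
Proof. exact: adjoint_funE. Qed.

Lemma adjoint_unique T S : (forall x y, '[T x, y] = '[x, S y]) -> adjoint T = S.
Proof.
by move=> TS; apply: bop_ext => y; apply: inner_ext => x; rewrite -adjointP TS.
Qed.

End Adjoint.

Section Dynamics.
Variables (R : realType) (A : cstarAlgType R).

Definition closed_ideal (J : set A) :=
  [/\ closed J, J 0, forall a b, J a -> J b -> J (a + b),
      forall a b, J b -> J (a * b) & forall a b, J b -> J (b * a)].

Record star_endomorphism := StarEndomorphism {
  endo_fun :> {linear A -> A};
  endoM : {morph endo_fun : a b / a * b};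
  endo_star : {morph endo_fun : a / star a} }.

Record representation (alpha : star_endomorphism) (H : hilbertType R) :=
  Representation {
    rep_pi :> {linear A -> bop H};
    rep_U : bop H;
    rep_pi1 : rep_pi 1 = 1;
    rep_piM : {morph rep_pi : a b / a * b};
    rep_pi_star : forall a, rep_pi (star a) = adjoint (rep_pi a);
    rep_implements : forall a,
      rep_U * rep_pi a * adjoint rep_U = rep_pi (alpha a) }.

Definition faithful alpha H (r : representation alpha H) := injective r.

Definition covariant alpha H (J : set A) (r : representation alpha H) :=
  J = [set a | adjoint (rep_U r) * rep_U r * r a = r a].

End Dynamics.

(* Main.v *)
Require Import Defs.
From HB Require Import structures.
From mathcomp Require Import all_boot all_order all_algebra.
From mathcomp Require Import sesquilinear complex ring lra zify.
From mathcomp Require Import finmap.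
From mathcomp Require Import boolp classical_sets functions fsbigop reals topology.
From mathcomp Require Import normedtype sequences.
From Stdlib Require setoid_ring.Ncring setoid_ring.Ncring_tac.

(** Every C*-identity below is reduced to the cone [pos] of squares of
    self-adjoint elements, which norm-convergent square roots make workable
    without any spectral theory; in particular every [star a * a] is a square.

    Let B be the algebra of bounded sequences in A.  For a positive functional
    Phi on B vanishing on finitely supported self-adjoint sequences with values
    in J, and for an integer d, let A act on B through
    [rho_d a = (alpha^(n+d) a)_n] (with 0 where n + d < 0) and let
    [X, Y |-> Phi (Y^* rho_d(1) X)] be the inner product.  On the direct sum over
    all (Phi, d), the operator U that lowers d by one implements alpha, and
    U^*U differs from the identity only in the entries with n + d = 0, where
    Phi cannot see J: elements of J are covariant.

    Conversely, a Hahn-Banach argument produces enough Phi.  If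
    Phi(star a a at entry 0) = 0 for all Phi, then a lies in J.  If
    Phi(rho_0(star a a)) = 0 for all Phi, then alpha^n(a) lies in J for all n
    and |alpha^n a| tends to 0; since ker alpha meets J trivially, alpha is
    isometric on J, so a = 0.

    The completion of a semi-inner product space is realized as its space of
    bounded antilinear functionals, on which an operator acts by precomposition
    with its adjoint. *)

Set Implicit Arguments.
Unset Strict Implicit.
Unset Printing Implicit Defensive.

Import Order.TTheory GRing.Theory Num.Theory ComplexField.
Import numFieldNormedType.Exports.

Local Open Scope classical_set_scope.
Local Open Scope complex_scope.
Local Open Scope ring_scope.

(** Why [Phi] has to vanish on finitely supported sequences only: a functional that kills every
    bounded sequence in [J] is blind to an element whose whole orbit under [alpha] stays in [J], and
    [pi] would not be injective on such elements. Sequences are bounded so that the constant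
    sequence 1 is an order unit, as the Hahn-Banach argument requires. The index d runs over all
    integers so that [U] and its adjoint re-index the summands bijectively; an entry with n + d = 0
    is moved by [U] to a place where rho_d(1) is 0, and is lost there. Since [alpha] need not be
    unital, rho_d(1) is only a projection; placed inside the inner product, it turns everything
    outside its range into null vectors, and [pi] becomes unital. Summing over all [Phi] makes it
    unnecessary to find a single functional that detects every element. *)

#[local] Instance pzRing_ncops (T : pzRingType) :
  @Ncring.Ring_ops T 0 1 +%R *%R (fun x y => x - y) -%R eq := {}.
#[local] Instance pzRing_ncring (T : pzRingType) :
  Ncring.Ring (Ro := pzRing_ncops T).
Proof.
split; try exact _.
- exact (@add0r T).
- exact (@addrC T).
- exact (@addrA T).
- exact (@mul1r T).
- exact (@mulr1 T).
- exact (@mulrA T).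
- exact (@mulrDl T).
- by move=> x y z; exact (@mulrDr T z x y).
- by [].
- exact (@subrr T).
Qed.
Ltac ncring := Ncring_tac.non_commutative_ring.

(** * Norms and square roots in a C*-algebra *)

Section RealNorm.
Context {R : realType} {V : normedModType R[i]}.
Implicit Types (x y : V) (r : R).

(** An [R]-valued norm: [R] is totally ordered, unlike [R[i]], and [lra] and [nra] apply to it. *)
Definition nrm x : R := complex.Re `|x|.

Lemma nrmE x : (nrm x)%:C = `|x|.
Proof. by rewrite /nrm RRe_real// normr_real. Qed.

Lemma nrm_ge0 x : 0 <= nrm x.
Proof. by rewrite -ler0c nrmE. Qed.

Lemma nrmD x y : nrm (x + y) <= nrm x + nrm y.
Proof. by rewrite -lecR rmorphD /= !nrmE ler_normD. Qed.

Lemma nrmN x : nrm (- x) = nrm x.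
Proof. by rewrite /nrm normrN. Qed.

Lemma nrmB x y : nrm (x - y) <= nrm x + nrm y.
Proof. by rewrite -(nrmN y) nrmD. Qed.

Lemma nrm_distC x y : nrm (x - y) = nrm (y - x).
Proof. by rewrite -nrmN opprB. Qed.

Lemma nrm0 : nrm 0 = 0.
Proof. by rewrite /nrm normr0. Qed.

Lemma nrm0_eq0 x : nrm x = 0 -> x = 0.
Proof. by move=> x0; apply/eqP; rewrite -normr_eq0 -nrmE x0. Qed.

Lemma nrmZ r x : nrm (r%:C *: x) = `|r| * nrm x.
Proof.
by apply: complexI; rewrite nrmE normrZ rmorphM /= nrmE normc_def /= expr0n addr0 sqrtr_sqr.
Qed.

Lemma nrm_eps0 x : (forall e, 0 < e -> nrm x <= e) -> x = 0.
Proof.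
move=> h; apply: nrm0_eq0; apply/le_anti; rewrite nrm_ge0 andbT.
by apply/ler_addgt0Pr => e /h; rewrite add0r.
Qed.

End RealNorm.

Section CompleteSeq.
Context {R : realType} {V : completeNormedModType R[i]}.

Lemma complete_seq (u : nat -> V) :
  (forall e : R, 0 < e -> exists N, forall n m, (N <= n)%N -> (N <= m)%N ->
     nrm (u n - u m) < e) ->
  exists l, forall e : R, 0 < e -> exists N, forall n, (N <= n)%N -> nrm (u n - l) < e.
Proof.
move=> h.
have : cauchy (u @ \oo).
  apply/cauchy_exP => e e0.
  have eE : (complex.Re e)%:C = e :> R[i] by rewrite RRe_real// gtr0_real.
  have [|N hN] := h (complex.Re e); first by rewrite -ltcR eE.
  exists (u N); exists N => // n /= Nn.
  by rewrite -ball_normE /= -eE -nrmE ltcR hN.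
move=> /cauchy_cvg/cvg_ex[l ul]; exists l => e e0.
have : (u @ \oo) (ball l e%:C) by apply: ul; apply: nbhsx_ballx; rewrite ltcR.
move=> [N _ hN]; exists N => n Nn; have := hN n Nn.
by rewrite -ball_normE /= -nrmE ltcR nrm_distC.
Qed.

End CompleteSeq.

Section CStarBasics.
Context {R : realType} {A : cstarAlgType R}.
Implicit Types (x y z h k b : A) (r t : R).

Lemma star0 : star (0 : A) = 0.
Proof. by have := starZ (0 : R[i]) (0 : A); rewrite conjC0 !scale0r. Qed.
Lemma starN x : star (- x) = - star x.
Proof. by apply/eqP; rewrite -subr_eq0 opprK -starD addNr star0. Qed.
Lemma starB x y : star (x - y) = star x - star y.
Proof. by rewrite starD starN. Qed.
Lemma star1 : star (1 : A) = 1.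
Proof. by rewrite -[LHS]mulr1 -{2}[1]starK -starM mulr1 starK. Qed.
Lemma starZr r x : star (r%:C *: x) = r%:C *: star x.
Proof. by rewrite starZ; congr (_ *: _); apply/CrealP/complex_realP; exists r. Qed.
Lemma starZi x : star ('i *: x) = - ('i *: star x).
Proof. by rewrite starZ conjCi scaleNr. Qed.

Lemma nrm_star_mul x : nrm (star x * x) = nrm x ^+ 2.
Proof. by apply: complexI; rewrite rmorphXn /= !nrmE cstar_norm. Qed.
Lemma nrmM x y : nrm (x * y) <= nrm x * nrm y.
Proof. by rewrite -lecR rmorphM /= !nrmE cstar_normM. Qed.
Lemma nrm_star x : nrm (star x) = nrm x.
Proof.
have le y : nrm y <= nrm (star y).
  have [->|y0] := eqVneq (nrm y) 0; first exact: nrm_ge0.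
  have yp : 0 < nrm y by rewrite lt_neqAle eq_sym y0 nrm_ge0.
  by rewrite -(ler_pM2r yp) -expr2 -nrm_star_mul nrmM.
by apply/le_anti; rewrite le -{2}(starK x) le.
Qed.
Lemma nrm_sa_sqr h : star h = h -> nrm (h * h) = nrm h ^+ 2.
Proof. by move=> hs; rewrite -{1}hs nrm_star_mul. Qed.
(** By the C*-identity [nrm 1] equals its own square. It is 0 in the zero algebra, hence an
    inequality. *)
Lemma nrm1_le1 : nrm (1 : A) <= 1.
Proof.
have := nrm_sa_sqr star1; rewrite mulr1 => /eqP.
rewrite expr2 -subr_eq0 -[X in X - _]mulr1 -mulrBr mulf_eq0 => /orP[/eqP->|]; first by rewrite ler01.
by rewrite subr_eq0 => /eqP <-.
Qed.

Definition comm_with x y := x * y = y * x.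

(** Iteration of y -> (x + y^2)/2. A fixed point satisfies (1 - y)^2 = 1 - x, so 1 - y is a square
    root of 1 - x. *)
Fixpoint sqrt_seq x n : A :=
  if n is m.+1 then (2^-1 : R)%:C *: (x + sqrt_seq x m * sqrt_seq x m) else 0.
(** The same iteration for the scalar x = 1. It increases and stays below 1, so it converges, and
    its increments dominate those of [sqrt_seq]. *)
Fixpoint sqrt_maj n : R :=
  if n is m.+1 then 2^-1 * (1 + sqrt_maj m * sqrt_maj m) else 0.

Lemma sqrt_maj01 n : 0 <= sqrt_maj n <= 1.
Proof. by elim: n => [|n /andP[h1 h2]] /=; [rewrite lexx ler01|nra]. Qed.

Lemma sqrt_maj_nd n : sqrt_maj n <= sqrt_maj n.+1.
Proof. by have /andP[h1 h2] := sqrt_maj01 n; rewrite /=; nra. Qed.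

Lemma sqrt_seq_comm x z n : comm_with z x -> comm_with z (sqrt_seq x n).
Proof.
rewrite /comm_with => zx; elim: n => [|n ih] /=; first by rewrite mulr0 mul0r.
by rewrite -cstar_scalerAl -cstar_scalerAr mulrDr mulrDl zx -mulrA -ih !mulrA ih.
Qed.

Lemma normr_half : `|(2^-1 : R)| = 2^-1. Proof. by rewrite ger0_norm// invr_ge0. Qed.

Lemma sqrt_seq_nrm x n : nrm x <= 1 -> nrm (sqrt_seq x n) <= sqrt_maj n.
Proof.
move=> x1; elim: n => [|n ih] /=; first by rewrite nrm0.
rewrite nrmZ normr_half ler_wpM2l ?invr_ge0//.
rewrite (le_trans (nrmD _ _))// lerD// (le_trans (nrmM _ _))//.
by apply: ler_pM; rewrite ?nrm_ge0.
Qed.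

(** The iterates commute, so a difference of two squares factors; the majorant factors in the same
    way, and the induction compares the factors. *)
Lemma sqrt_seq_diff x n : nrm x <= 1 ->
  nrm (sqrt_seq x n.+1 - sqrt_seq x n) <= sqrt_maj n.+1 - sqrt_maj n.
Proof.
move=> x1; elim: n => [|n ih].
  by have := sqrt_seq_nrm 1 x1; rewrite /= !subr0.
have -> : sqrt_seq x n.+2 - sqrt_seq x n.+1 =
    (2^-1 : R)%:C *: ((sqrt_seq x n.+1 - sqrt_seq x n) * (sqrt_seq x n.+1 + sqrt_seq x n)).
  have cm : comm_with (sqrt_seq x n.+1) (sqrt_seq x n).
    by apply: sqrt_seq_comm; apply/esym/sqrt_seq_comm.
  rewrite mulrDr !mulrBl [LHS]/= -scalerBr -/(sqrt_seq x n.+1); congr (_ *: _).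
  rewrite -cm opprD addrACA subrr add0r.
  by rewrite addrA subrK.
rewrite nrmZ normr_half.
have -> : sqrt_maj n.+2 - sqrt_maj n.+1 =
    2^-1 * ((sqrt_maj n.+1 - sqrt_maj n) * (sqrt_maj n.+1 + sqrt_maj n)).
  rewrite -[sqrt_maj n.+2]/(2^-1 * (1 + sqrt_maj n.+1 * sqrt_maj n.+1)).
  by rewrite [X in _ - X = _]/=; ring.
rewrite ler_wpM2l ?invr_ge0// (le_trans (nrmM _ _))//.
apply: ler_pM; rewrite ?nrm_ge0//.
by rewrite (le_trans (nrmD _ _))// lerD ?sqrt_seq_nrm.
Qed.

Lemma sqrt_seq_dist x n m : nrm x <= 1 -> (n <= m)%N ->
  nrm (sqrt_seq x m - sqrt_seq x n) <= sqrt_maj m - sqrt_maj n.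
Proof.
move=> x1 /subnK <-; elim: (m - n)%N => [|k ih]; first by rewrite add0n !subrr nrm0.
rewrite addSn -(subrK (sqrt_seq x (k + n)) (sqrt_seq x _.+1)) -addrA.
rewrite (le_trans (nrmD _ _))//.
have := sqrt_seq_diff (k + n) x1; lra.
Qed.

(** The commutation clause stands in for the functional calculus: it makes the roots of commuting
    elements commute. *)
Lemma sqrt_exists x : nrm x <= 1 -> exists y, [/\ y + y = x + y * y, nrm y <= 1,
  star x = x -> star y = y & forall z, comm_with z x -> comm_with z y].
Proof.
move=> x1.
have tcvg : cvgn (sqrt_maj : nat -> R).
  apply: nondecreasing_is_cvgn; first by apply/nondecreasing_seqP => n; exact: sqrt_maj_nd.
  by exists 1 => _ [n _ <-]; have /andP[] := sqrt_maj01 n.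
have tle m n : (m <= n)%N -> sqrt_maj m <= sqrt_maj n.
  move=> mn; have /nondecreasing_seqP := sqrt_maj_nd; exact.
have [|y hy] := @complete_seq _ A (sqrt_seq x).
  move=> e e0; have /cvgrPdist_lt/(_ _ e0)[N _ hN] := tcvg.
  have tl n : sqrt_maj n <= limn (sqrt_maj : nat -> R).
    by apply: nondecreasing_cvgn_le => //; apply/nondecreasing_seqP => ?; exact: sqrt_maj_nd.
  have hl n : (N <= n)%N -> sqrt_maj n > limn (sqrt_maj : nat -> R) - e.
    move=> Nn; have := hN n Nn => /=; rewrite ger0_norm ?subr_ge0//; lra.
  exists N => n m Nn Nm.
  wlog nm : n m Nn Nm / (n <= m)%N.
    by move=> wl; case/orP: (leq_total n m) => ?; [|rewrite nrm_distC]; apply: wl.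
  rewrite nrm_distC (le_lt_trans (sqrt_seq_dist x1 nm))//.
  have := hl _ Nn; have := tl m; lra.
have y1 : nrm y <= 1.
  apply/ler_addgt0Pr => e /hy[N /(_ N (leqnn N))]; rewrite nrm_distC => h.
  rewrite -(subrK (sqrt_seq x N) y) (le_trans (nrmD _ _))//.
  have := sqrt_seq_nrm N x1; have /andP[] := sqrt_maj01 N; lra.
have approx e : 0 < e -> exists n, nrm (sqrt_seq x n - y) < e /\ nrm (sqrt_seq x n.+1 - y) < e.
  by move=> /hy[N hN]; exists N; split; apply: hN.
exists y; split => //.
- apply/eqP; rewrite -subr_eq0; apply/eqP/nrm_eps0 => e e0.
  (* Each of the four error terms below is at most e/4, because [y] and [yn] have norm at most 1. *)
  have [|n [h1 h2]] := approx (e / 4); first by rewrite divr_gt0.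
  have E : sqrt_seq x n.+1 + sqrt_seq x n.+1 = x + sqrt_seq x n * sqrt_seq x n.
    rewrite /= -scalerDl -rmorphD /=.
    by rewrite (_ : 2^-1 + 2^-1 = 1) ?scale1r//; field.
  set yn := sqrt_seq x n in h1 E; set ym := sqrt_seq x n.+1 in h2 E.
  have -> : y + y - (x + y * y) = (y - ym) + (y - ym) + (yn - y) * yn + y * (yn - y).
    have -> : x = ym + ym - yn * yn by rewrite E addrK.
    ncring.
  rewrite nrm_distC in h2.
  have hyn : nrm yn <= 1 by rewrite (le_trans (sqrt_seq_nrm n x1))//; have /andP[] := sqrt_maj01 n.
  rewrite (le_trans (nrmD _ _))//.
  have := nrmM y (yn - y); have := nrmM (yn - y) yn.
  have := nrmD (y - ym + (y - ym)) ((yn - y) * yn).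
  have := nrmD (y - ym) (y - ym).
  have := nrm_ge0 (yn - y); have := nrm_ge0 yn; have := nrm_ge0 y; nra.
- move=> xs; apply/eqP; rewrite -subr_eq0; apply/eqP/nrm_eps0 => e e0.
  have sn n : star (sqrt_seq x n) = sqrt_seq x n.
    by elim: n => [|n ih] /=; rewrite ?star0// starZr starD starM ih xs.
  have [|n [h1 _]] := approx (e / 2); first by rewrite divr_gt0.
  have -> : star y - y = star (y - sqrt_seq x n) + (sqrt_seq x n - y).
    by rewrite starB sn subrKA.
  rewrite (le_trans (nrmD _ _))// nrm_star nrm_distC; lra.
- move=> z zx; apply/eqP; rewrite -subr_eq0; apply/eqP/nrm_eps0 => e e0.
  have z0 := nrm_ge0 z.
  have [|n [h1 _]] := approx (e / (2 * (nrm z + 1))); first by rewrite divr_gt0//; lra.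
  have -> : z * y - y * z = (sqrt_seq x n - y) * z - z * (sqrt_seq x n - y).
    by rewrite mulrBl mulrBr -(sqrt_seq_comm n zx) opprB [RHS]addrC subrKA.
  move: h1; rewrite ltr_pdivlMr; last lra.
  have := nrmB ((sqrt_seq x n - y) * z) (z * (sqrt_seq x n - y)).
  have := nrmM (sqrt_seq x n - y) z; have := nrmM z (sqrt_seq x n - y).
  have := nrm_ge0 (sqrt_seq x n - y); nra.
Qed.

End CStarBasics.

(** * The positive cone *)

Section Positive.
Context {R : realType} {A : cstarAlgType R}.
Implicit Types (x y z h k b u w : A) (r t : R).

Lemma scMl r x y : (r%:C *: x) * y = r%:C *: (x * y).
Proof. by rewrite cstar_scalerAl. Qed.
Lemma scMr r x y : x * (r%:C *: y) = r%:C *: (x * y).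
Proof. by rewrite cstar_scalerAr. Qed.
Lemma scZ r t x : r%:C *: (t%:C *: x) = (r * t)%:C *: x.
Proof. by rewrite scalerA rmorphM. Qed.

(** For u = a + i b commutation gives [star u * u] = a^2 + b^2, and a is the real part of u, so |a|
    <= |u|. *)
Lemma nrm_sqr_le a b : star a = a -> star b = b -> comm_with a b ->
  nrm (a * a) <= nrm (a * a + b * b).
Proof.
move=> sa sb ab; pose u := a + 'i *: b.
have su : star u = a - 'i *: b by rewrite /u starD starZi sa sb.
have <- : star u * u = a * a + b * b.
  rewrite su /u mulrDr !mulrBl -!cstar_scalerAl -!cstar_scalerAr scalerA -(expr2 'i) sqrCi scaleN1r.
  by rewrite ab opprK addrA subrK.
rewrite nrm_star_mul nrm_sa_sqr// ler_pXn2r ?nnegrE ?nrm_ge0//.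
have -> : a = (2^-1 : R)%:C *: (u + star u).
  have -> : u + star u = a + a by rewrite su /u; ncring.
  by rewrite scalerDr -scalerDl -rmorphD /= (_ : 2^-1 + 2^-1 = 1) ?scale1r//; field.
rewrite nrmZ normr_half; have := nrmD u (star u); rewrite nrm_star; lra.
Qed.

(* With [w] a square root of [1 - b^2], the element [w + i b] is unitary and [w]
   is its real part. *)
Lemma nrm_1_sqr b : star b = b -> nrm b <= 1 -> nrm (1 - b * b) <= 1.
Proof.
move=> sb b1.
have [|y [y2 y1 ys yc]] := @sqrt_exists _ _ (b * b).
  by rewrite (le_trans (nrmM _ _))// mulr_ile1// nrm_ge0.
have {}ys : star y = y by apply: ys; rewrite starM sb.
have -> : 1 - b * b = (1 - y) * (1 - y).
  have -> : b * b = y + y - y * y by rewrite y2 addrK.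
  by ncring.
have yb : comm_with b y by apply: yc; rewrite /comm_with mulrA.
have /le_trans -> // : nrm ((1 - y) * (1 - y)) <= nrm ((1 - y) * (1 - y) + b * b).
  apply: nrm_sqr_le => //; first by rewrite starB star1 ys.
  by rewrite /comm_with mulrBl mulrBr mul1r mulr1 yb.
have -> : (1 - y) * (1 - y) + b * b = 1.
  have -> : b * b = y + y - y * y by rewrite y2 addrK.
  by ncring.
exact: nrm1_le1.
Qed.

Definition pos h := exists2 k, star k = k & h = k * k.

Lemma pos_sa h : pos h -> star h = h.
Proof. by move=> [k ks ->]; rewrite starM ks. Qed.

Lemma posZ r h : 0 <= r -> pos h -> pos (r%:C *: h).
Proof.
move=> r0 [k ks ->]; exists ((Num.sqrt r)%:C *: k); first by rewrite starZr ks.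
by rewrite scMl scMr scZ -(expr2 (Num.sqrt _)) sqr_sqrtr.
Qed.

Lemma pos_sqrtZ t k : 0 <= t -> ((Num.sqrt t)%:C *: k) * ((Num.sqrt t)%:C *: k) = t%:C *: (k * k).
Proof. by move=> t0; rewrite scMl scMr scZ -(expr2 (Num.sqrt _)) sqr_sqrtr. Qed.

(** The condition |t - h| <= t plays the part of 0 <= h <= 2t. After rescaling to t = 1 the root [k]
    again satisfies |1 - k| <= 1, and a second extraction exhibits [k] itself as a square. *)
Lemma pos_root t h : star h = h -> 0 < t -> nrm (t%:C *: (1 : A) - h) <= t ->
  exists k, [/\ pos k, h = k * k & forall z, comm_with z h -> comm_with z k].
Proof.
have one g : star g = g -> nrm (1 - g) <= 1 ->
    exists k, [/\ star k = k, nrm (1 - k) <= 1, g = k * k & forall z, comm_with z g -> comm_with z k].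
  move=> gs /sqrt_exists[y [y2 y1 ys yc]]; exists (1 - y); split.
  - by rewrite starB star1 ys// starB star1 gs.
  - by rewrite opprB addrCA subrr addr0.
  - have -> : g = 1 - (y + y - y * y) by rewrite y2 addrK opprB addrC subrK.
    by ncring.
  - move=> z zg; have zy : comm_with z y.
      by apply: yc; rewrite /comm_with mulrBl mulrBr mul1r mulr1 zg.
    by rewrite /comm_with mulrBl mulrBr mul1r mulr1 zy.
move=> hs t0 ht.
have tK (g : A) : g = t%:C *: ((t^-1)%:C *: g) by rewrite scZ divff ?gt_eqF// scale1r.
have [||k [ks k1 hk kc]] := one ((t^-1)%:C *: h).
- by rewrite starZr hs.
- rewrite -(ler_pM2l t0) mulr1; apply: le_trans ht.
  by rewrite -[X in X * _]gtr0_norm// -nrmZ scalerBr -tK.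
have [//|//|m [ms m1 km mc]] := one k.
exists ((Num.sqrt t)%:C *: k); split.
- by apply: posZ; [rewrite sqrtr_ge0|exists m].
- by rewrite pos_sqrtZ ?ltW// -hk -tK.
- move=> z zh; rewrite /comm_with scMr scMl; congr (_ *: _); apply: kc.
  by rewrite /comm_with scMr scMl zh.
Qed.

(** A converse of [pos_root]. Together they turn positivity into a norm inequality, for which
    stability under sums is the triangle inequality. *)
Lemma pos_nrm t h : pos h -> 0 < t -> nrm h <= t -> nrm (t%:C *: (1 : A) - h) <= t.
Proof.
move=> [k ks ->] t0; rewrite nrm_sa_sqr// => kt.
have st : 0 < Num.sqrt t by rewrite sqrtr_gt0.
have st2 : Num.sqrt t ^+ 2 = t by rewrite sqr_sqrtr// ltW.
pose b := ((Num.sqrt t)^-1)%:C *: k.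
have -> : k * k = t%:C *: (b * b).
  rewrite -(pos_sqrtZ _ (ltW t0)) /b scZ divff ?gt_eqF// !scale1r//.
rewrite -scalerBr nrmZ gtr0_norm// -[leRHS]mulr1 ler_wpM2l ?(ltW t0)//.
apply: nrm_1_sqr; first by rewrite /b starZr ks.
rewrite /b nrmZ gtr0_norm ?invr_gt0// mulrC ler_pdivrMr// mul1r.
by rewrite -(ler_pXn2r (n := 2)) ?nnegrE ?nrm_ge0// ?(ltW st)// st2.
Qed.

Lemma pos_sqrt h : pos h ->
  exists k, [/\ pos k, h = k * k & forall z, comm_with z h -> comm_with z k].
Proof.
move=> hp; have n0 := nrm_ge0 h.
apply: (@pos_root (nrm h + 1)); [exact: pos_sa|lra|by apply: pos_nrm => //; lra].
Qed.

Lemma posD h k : pos h -> pos k -> pos (h + k).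
Proof.
move=> hp kp; have n0 := nrm_ge0 h; have m0 := nrm_ge0 k.
pose t := nrm h + nrm k + 1.
have t0 : 0 < t by rewrite /t; lra.
have [|||m [/pos_sa ms -> _]] := @pos_root (t + t) (h + k); last by exists m.
- by rewrite starD !pos_sa.
- lra.
rewrite rmorphD scalerDl opprD addrACA (le_trans (nrmD _ _))//.
by rewrite lerD// pos_nrm// /t; lra.
Qed.

Lemma pos_sqr k : star k = k -> pos (k * k).
Proof. by exists k. Qed.

Lemma pos1 : pos (1 : A).
Proof. by exists 1; rewrite ?star1 ?mulr1. Qed.

Lemma pos0 : pos (0 : A).
Proof. by exists 0; rewrite ?star0 ?mulr0. Qed.

Lemma nrm_le_addr u w : pos u -> pos w -> comm_with u w -> nrm u <= nrm (u + w).
Proof.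
move=> /pos_sqrt[a [/pos_sa sa -> ca]] /pos_sqrt[b [/pos_sa sb -> cb]] uw.
by apply: nrm_sqr_le => //; apply: cb; apply/esym/ca/esym.
Qed.

Lemma pos_anti h : pos h -> pos (- h) -> h = 0.
Proof.
move=> hp hm; apply: nrm0_eq0; apply/le_anti; rewrite nrm_ge0 andbT.
have := nrm_le_addr hp hm; rewrite subrr nrm0; apply.
by rewrite /comm_with mulrN mulNr.
Qed.

(** This replaces the spectral radius formula for self-adjoint elements. *)
Lemma nrm_pow2 h n : star h = h -> nrm (h ^+ (2 ^ n)) = nrm h ^+ (2 ^ n).
Proof.
move=> hs; elim: n => [|n ih]; first by rewrite !expn0 !expr1.
have hX m : star (h ^+ m) = h ^+ m.
  by elim: m => [|m im]; rewrite ?star1// exprSr starM im hs -exprS exprSr.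
by rewrite expnSr !exprM expr2 nrm_sa_sqr ?ih.
Qed.

End Positive.

(** * Positivity of [star a * a] *)

Section PositiveStar.
Context {R : realType} {A : cstarAlgType R}.
Implicit Types (a b c h k u w x y z : A) (r t : R).

(** Write F = 1 + e and take N = 2^n > 2/e^2. Bernoulli gives only linear growth, F^N >= 1 + N e;
    its square (1 + N e)^2 exceeds 2 N + 1, the bound at exponent 2 N. *)
Lemma le1_of_pow2 (F : R) : 0 <= F ->
  (forall n, F ^+ (2 ^ n) <= (2 ^ n).+1%:R) -> F <= 1.
Proof.
move=> F0 hF; rewrite leNgt; apply/negP => F1.
pose e := F - 1; have e0 : 0 < e by rewrite /e; lra.
have bern n : 1 + n%:R * e <= F ^+ n.
  elim: n => [|n ih]; first by rewrite mul0r addr0 expr0.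
  rewrite exprS -natr1; move: (F ^+ n) (n%:R) (ler0n R n) ih => p q q0 ih.
  have -> : F = 1 + e by rewrite /e addrC subrK.
  have : 0 <= (1 + e) * (p - (1 + q * e)) by rewrite mulr_ge0 ?subr_ge0//; lra.
  have : 0 <= q * (e * e) by rewrite !mulr_ge0// ltW.
  by nra.
have [n hn] : exists n : nat, 2 / e ^+ 2 < n%:R.
  by exists (Num.truncn (2 / e ^+ 2)).+1; apply: Num.Theory.truncnS_gt.
have n2 : n%:R <= (2 ^ n)%:R :> R by rewrite ler_nat ltnW// ltn_expl.
have := hF n.+1; rewrite expnSr exprM -natr1 natrM.
have := bern (2 ^ n)%N; set N : R := (2 ^ n)%:R.
have : 2 < N * e ^+ 2 by rewrite -ltr_pdivrMr ?exprn_gt0// (lt_le_trans hn).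
have N0 : 0 <= N by rewrite /N.
move=> h1 h2; apply/negP; rewrite -ltNge.
have h3 : 0 <= N * e by rewrite mulr_ge0// ltW.
have : (1 + N * e) ^+ 2 <= (F ^+ (2 ^ n)) ^+ 2.
  by rewrite ler_pXn2r// nnegrE ?exprn_ge0//; lra.
apply: lt_le_trans; nra.
Qed.

Lemma swap_pow b n :
  b * (1 - star b * b) ^+ n = (1 - b * star b) ^+ n * b.
Proof.
elim: n => [|n ih]; first by rewrite !expr0 mulr1 mul1r.
by rewrite exprSr mulrA ih exprSr -!mulrA mulrBr mulrBl mulr1 mul1r mulrA.
Qed.

Lemma sa_starM a : star (star a * a) = star a * a.
Proof. by rewrite starM starK. Qed.
Lemma sa_1B h : star h = h -> star (1 - h) = 1 - h.
Proof. by move=> hs; rewrite starB star1 hs. Qed.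
Lemma sa_exp h n : star h = h -> star (h ^+ n) = h ^+ n.
Proof. by move=> hs; elim: n => [|m im]; rewrite ?star1// exprSr starM im hs -exprS exprSr. Qed.

(* Since [b (1 - b^* b)^n = (1 - b b^* )^n b], the powers of [1 - b^* b] grow at
   most linearly; but [|h^(2^n)| = |h|^(2^n)] for self-adjoint [h]. *)
Lemma swap_nrm b : nrm b <= 1 -> nrm (1 - b * star b) <= 1 ->
  nrm (1 - star b * b) <= 1.
Proof.
move=> b1 y1; set x := star b * b.
have powle h n : nrm h <= 1 -> nrm (h ^+ n) <= 1.
  move=> h1; elim: n => [|n ih]; first exact: nrm1_le1.
  by rewrite exprS (le_trans (nrmM _ _))// mulr_ile1 ?nrm_ge0.
have xs : star (1 - x) = 1 - x by rewrite sa_1B ?sa_starM.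
(* By the C*-identity the square of this norm is |x (1 - x)^(2m) x|; moving one [b] across the power
   leaves a power of [1 - b * star b], of norm at most 1. *)
have gle m : nrm ((1 - x) ^+ m * x) <= 1.
  rewrite -(ler_pXn2r (n := 2)) ?nnegrE ?nrm_ge0// expr1n -nrm_star_mul.
  rewrite starM sa_exp// sa_starM mulrA -(mulrA x) -exprD.
  have -> : x * (1 - x) ^+ (m + m) * x = star b * (1 - b * star b) ^+ (m + m) * (b * x).
    by rewrite {1}/x -[star b * b * _]mulrA swap_pow -!mulrA.
  rewrite (le_trans (nrmM _ _))// mulr_ile1 ?nrm_ge0// (le_trans (nrmM _ _))//.
    by rewrite mulr_ile1 ?nrm_ge0 ?nrm_star ?powle.
  by rewrite mulr_ile1 ?nrm_ge0// (le_trans (nrmM _ _))// mulr_ile1 ?nrm_ge0 ?nrm_star.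
(* From (1 - x)^(m+1) = (1 - x)^m - (1 - x)^m x: each step adds at most 1. *)
have Fle m : nrm ((1 - x) ^+ m) <= m.+1%:R.
  elim: m => [|m ih]; first exact: nrm1_le1.
  rewrite exprSr mulrBr mulr1 (le_trans (nrmB _ _))//.
  by rewrite -[in leRHS]natr1 lerD.
apply: le1_of_pow2 => [|n]; first exact: nrm_ge0.
by rewrite -nrm_pow2.
Qed.

(** For contractions, positivity of h is the norm inequality |1 - h| <= 1, which [swap_nrm]
    transfers; [t] rescales [b] to a contraction. *)
Lemma pos_swap b : pos (b * star b) -> pos (star b * b).
Proof.
move=> bp; pose t := nrm b + 1; have n0 := nrm_ge0 b.
have t0 : 0 < t by rewrite /t; lra.
pose c := (t^-1)%:C *: b.
have bc : b = t%:C *: c by rewrite scZ divff ?gt_eqF// scale1r.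
have c1 : nrm c <= 1.
  by rewrite nrmZ gtr0_norm ?invr_gt0// mulrC ler_pdivrMr// mul1r /t; lra.
have cp : pos (c * star c).
  rewrite /c starZr scMl scMr scZ; apply: posZ => //.
  by rewrite mulr_ge0// invr_ge0 ltW.
have sc1 (x : A) : 1%:C *: x = x by rewrite scale1r.
suff : pos (star c * c).
  by move=> cp'; rewrite bc starZr scMl scMr scZ; apply: posZ => //; rewrite mulr_ge0// ltW.
have [|||k [/pos_sa ks -> _]] := @pos_root _ _ 1 (star c * c); last by exists k.
- exact: sa_starM.
- exact: ltr01.
rewrite sc1; apply: swap_nrm => //.
rewrite -(sc1 1); apply: pos_nrm => //.
by rewrite (le_trans (nrmM _ _))// nrm_star mulr_ile1 ?nrm_ge0.
Qed.

Lemma sa_cube_eq0 h : star h = h -> h * h * h = 0 -> h = 0.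
Proof.
move=> hs h3; apply: nrm0_eq0; apply/eqP.
have : nrm ((h * h) * (h * h)) == 0 by rewrite mulrA h3 mul0r nrm0.
by rewrite nrm_sa_sqr ?starM ?hs// nrm_sa_sqr// !sqrf_eq0.
Qed.

Lemma pos_starM_add a : pos (a * star a + star a * a).
Proof.
pose x := a + star a; pose y := 'i *: (a - star a).
have xs : star x = x by rewrite /x starD starK addrC.
have ys : star y = y by rewrite /y starZi starB starK -scalerN opprB.
have -> : a * star a + star a * a = (2^-1)%:C *: (x * x + y * y).
  rewrite /y -cstar_scalerAl -cstar_scalerAr scalerA -(expr2 'i) sqrCi scaleN1r.
  set z := LHS; have -> : x * x - (a - star a) * (a - star a) = z + z.
    by rewrite /x /z; ncring.
  by rewrite scalerDr -scalerDl -rmorphD /= (_ : 2^-1 + 2^-1 = 1) ?scale1r//; field.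
by apply: posZ; [rewrite invr_ge0|apply: posD; apply: pos_sqr].
Qed.

Lemma pos_mul_mul v w : star v = v -> pos w -> comm_with v w -> pos (v * w * v).
Proof.
move=> vs /pos_sqrt[m [/pos_sa ms -> mc]] vw.
have vm : v * m = m * v by apply: mc.
exists (v * m); first by rewrite starM ms vs vm.
by rewrite [in RHS]vm !mulrA vm.
Qed.

(* [v] is twice the negative part of [h = a^* a].  For [b = a v] the element
   [b^* b = - v w v] is negative, and [b b^* + b^* b] is a sum of squares, so
   [b b^*] and then [b^* b] are positive; hence [b^* b = 0] and [v = 0]. *)
Lemma pos_starM a : pos (star a * a).
Proof.
set h := star a * a; have hs : star h = h := sa_starM a.
have [w [wp hw wc]] := pos_sqrt (pos_sqr hs).
have hwc : h * w = w * h by apply: wc; rewrite /comm_with mulrA.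
have ws := pos_sa wp.
pose v := w - h; have vs : star v = v by rewrite /v starB ws hs.
have wh0 : (w + h) * v = 0.
  by rewrite /v mulrBr !mulrDl hw hwc [X in _ - X]addrC subrr.
have vp : pos (v * w * v).
  by apply: pos_mul_mul => //; rewrite /comm_with /v mulrBl mulrBr hwc.
have vhv : v * h * v = - (v * w * v).
  by apply/eqP; rewrite -addr_eq0 -mulrDl -mulrDr addrC -mulrA wh0 mulr0.
pose b := a * v.
have bb : star b * b = v * h * v by rewrite /b starM vs /h !mulrA.
have b0 : v * h * v = 0.
  apply: pos_anti; last by rewrite vhv opprK.
  rewrite -bb; apply: pos_swap.
  have -> : b * star b = (b * star b + star b * b) + v * w * v.
    by rewrite bb vhv addrNK.
  by apply: posD => //; exact: pos_starM_add.
have v0 : v = 0.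
  apply: sa_cube_eq0 => //.
  have -> : v * v * v = v * w * v - v * h * v by rewrite -mulrBl -mulrBr.
  rewrite b0 subr0.
  by apply/eqP; rewrite -oppr_eq0 -vhv b0.
by rewrite (_ : h = w)//; apply/esym/eqP; rewrite -subr_eq0 -/v v0.
Qed.

Lemma pos_conj c h : pos h -> pos (star c * h * c).
Proof.
by move=> [k ks ->]; have := pos_starM (k * c); rewrite starM ks !mulrA.
Qed.

Lemma sa_nrm_pos r h : star h = h -> nrm h <= r -> pos (r%:C *: (1 : A) - h).
Proof.
move=> hs hr; have [r0|] := ltP 0 r; last first.
  move=> r0; have h0 : h = 0.
    by apply: nrm0_eq0; apply/le_anti; rewrite nrm_ge0 andbT (le_trans hr).
  have {r0}-> : r = 0 by apply/le_anti; rewrite r0 (le_trans (nrm_ge0 h)).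
  by rewrite h0 scale0r subr0; exact: pos0.
have [|||k [/pos_sa ks -> _]] := @pos_root _ A r (r%:C *: (1 : A) - h) ; last exact: pos_sqr.
- by rewrite starB hs starZr star1.
- by [].
- by rewrite opprB addrCA subrr addr0.
Qed.

Lemma nrm_le_of_pos r u : 0 <= r -> pos u -> pos (r%:C *: (1 : A) - u) -> nrm u <= r.
Proof.
move=> r0 up wp; have := nrm_le_addr up wp; rewrite addrCA subrr addr0.
move=> /(_ _)/le_trans; apply; first by rewrite /comm_with mulrBr mulrBl scMl scMr mulr1 mul1r.
by rewrite nrmZ ger0_norm// ler_piMr// nrm1_le1.
Qed.

Lemma nrm_sqr_le_of_pos r a : 0 <= r -> pos (r%:C *: (1 : A) - star a * a) -> nrm a ^+ 2 <= r.
Proof. by move=> r0 /(nrm_le_of_pos r0 (pos_starM a)); rewrite nrm_star_mul. Qed.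

Lemma pos_nrm_sqr a : pos ((nrm a ^+ 2)%:C *: (1 : A) - star a * a).
Proof. by apply: sa_nrm_pos; rewrite ?sa_starM ?nrm_star_mul. Qed.

End PositiveStar.

(** * Ideals and endomorphisms *)

Section IdealsEndomorphisms.
Context {R : realType} {A : cstarAlgType R}.
Implicit Types (a b c h k u v w x y z : A) (r s t : R) (J : set A).

Lemma nrm_mono u v : pos u -> pos (v - u) -> nrm u <= nrm v.
Proof.
move=> up vu; apply: nrm_le_of_pos; rewrite ?nrm_ge0//.
have vp : pos v by rewrite -(subrK u v); apply: posD.
rewrite -(subrK v (_ *: (1 : A))) -addrA; apply: posD => //.
by apply: sa_nrm_pos => //; exact: pos_sa.
Qed.

(** For d = u - v the product (u + v) d is 0, so the positive elements d u d and d v d add up to 0.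
    Both vanish, and so does their difference d^3. *)
Lemma pos_sqr_inj u v : pos u -> pos v -> comm_with u v -> u * u = v * v -> u = v.
Proof.
move=> up vp uv uu; pose d := u - v.
have ds : star d = d by rewrite /d starB !pos_sa.
have du : comm_with d u by rewrite /comm_with /d mulrBl mulrBr uv.
have dv : comm_with d v by rewrite /comm_with /d mulrBl mulrBr uv.
have h0 : d * u * d + d * v * d = 0.
  rewrite -mulrDl -mulrDr -mulrA.
  suff -> : (u + v) * d = 0 by rewrite mulr0.
  by rewrite /d mulrBr !mulrDl uu uv [X in _ - X]addrC subrr.
have h1 : d * u * d = 0.
  apply: pos_anti; first exact: pos_mul_mul.
  suff -> : - (d * u * d) = d * v * d by exact: pos_mul_mul.
  by apply/esym/eqP; rewrite -addr_eq0 addrC h0.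
move: h0; rewrite h1 add0r => h2.
apply/eqP; rewrite -subr_eq0 -/d; apply/eqP/sa_cube_eq0 => //.
have -> : d * d * d = d * u * d - d * v * d by rewrite -mulrBl -mulrBr.
by rewrite h1 h2 subrr.
Qed.

Section Ideal.
Variable J : set A.
Hypothesis hJ : closed_ideal J.

Lemma idealD a b : J a -> J b -> J (a + b).
Proof. by case: hJ => _ _ + _ _; exact. Qed.
Lemma idealMl a b : J b -> J (a * b).
Proof. by case: hJ => _ _ _ + _; exact. Qed.
Lemma idealMr a b : J b -> J (b * a).
Proof. by case: hJ => _ _ _ _; exact. Qed.
Lemma ideal0 : J 0. Proof. by case: hJ. Qed.
Lemma idealZ (l : R[i]) a : J a -> J (l *: a).
Proof. by rewrite -[a]mul1r cstar_scalerAl => Ja; apply: idealMl; rewrite mul1r in Ja. Qed.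

Lemma ideal_closed a :
  (forall e : R, 0 < e -> exists2 j, J j & nrm (a - j) < e) -> J a.
Proof.
move=> h; have [+ _ _ _ _] := hJ; apply => B /nbhs_ballP[e e0 aB].
have eE : (complex.Re e)%:C = e :> R[i] by rewrite RRe_real// gtr0_real.
have [|j Jj aj] := h (complex.Re e); first by rewrite -ltcR eE.
exists j; split=> //; apply: aB.
by rewrite -ball_normE /= -eE -nrmE ltcR.
Qed.

(* With [k] a positive element of [J] such that [a^* a <= 2 s + s k], the cutoff
   [c = sqrt (1 + k^2) - k] satisfies [c^2 + 2 k c = 1]: thus [a - a c^2] is in
   [J], and [a c^2] is small because [k c <= 1/2]. *)
Lemma ideal_of_approx a :
  (forall s, 0 < s ->
    exists j, [/\ J j, star j = j & pos (s%:C *: (1 : A) + j - star a * a)]) ->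
  J a.
Proof.
move=> happ; apply: ideal_closed => e e0 /=.
pose s := e ^+ 2 / 4; have s0 : 0 < s by rewrite divr_gt0 ?exprn_gt0.
have [j [Jj js jp]] := happ s s0.
(* This is q^2 for q = j/(2s), and s (1 - q)^2 >= 0 expands to j <= s + s k. It trades [j], which
   need not be positive, for a positive element of [J]. *)
pose k := ((4 * s * s)^-1)%:C *: (j * j).
have s4 : 0 < 4 * s * s by nra.
have kp : pos k by apply: posZ; [rewrite invr_ge0 ltW|exact: pos_sqr].
have Jk : J k by apply/idealZ/idealMl.
have ks := pos_sa kp.
have abnd : pos ((2 * s)%:C *: (1 : A) + s%:C *: k - star a * a).
  pose q := ((2 * s)^-1)%:C *: j.
  have qs : star q = q by rewrite /q starZr js.
  have qq : q * q = k.
    by rewrite /q /k scMl scMr scZ; congr (_%:C *: _); field; rewrite gt_eqF.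
  have sq : s%:C *: (q + q) = j.
    rewrite -scalerDl -rmorphD scZ (_ : s * _ = 1) ?scale1r//.
    by field; rewrite gt_eqF.
  pose b : A := 1 - q.
  have bs : star b = b by rewrite /b starB star1 qs.
  have sbb : s%:C *: (b * b) = s%:C *: (1 : A) + s%:C *: k - j.
    have -> : b * b = 1 + k - (q + q) by rewrite -qq /b; ncring.
    by rewrite scalerBr scalerDr sq.
  have -> : (2 * s)%:C *: (1 : A) + s%:C *: k - star a * a =
      (s%:C *: (1 : A) + j - star a * a) + s%:C *: (b * b).
    rewrite sbb mulr2n mulrDl mul1r rmorphD /= scalerDl.
    by ncring.
  by apply: posD => //; apply: posZ; [exact: ltW|exact: pos_sqr].
have [|w [wp ww wc]] := @pos_sqrt _ _ (1 + k * k).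
  by apply: posD; [exact: pos1|exact: pos_sqr].
have kw : k * w = w * k by apply: wc; rewrite /comm_with mulrDl mulrDr mulr1 mul1r mulrA.
pose c := w - k; have cs : star c = c by rewrite /c starB ks pos_sa.
have kc : k * c = c * k by rewrite /c mulrBl mulrBr kw.
have wc' : c * w = w * c by rewrite /c mulrBl mulrBr kw.
have c1 : c * (w + k) = 1.
  have -> : 1 = w * w - k * k by rewrite -ww addrK.
  by rewrite /c mulrBl !mulrDr kw; ncring.
have cc : 1 - c * c = k * c + k * c.
  have wkc : w + k - c = k + k by rewrite /c; ncring.
  by rewrite -{1}c1 -mulrBr wkc mulrDr kc.
have cp : pos c.
  have -> : c = c * w * c + c * k * c by rewrite -mulrDl -mulrDr c1 mul1r.
  by apply: posD; apply: pos_mul_mul.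
have kcp : pos (k * c).
  have [m [/pos_sa ms km mc]] := pos_sqrt kp.
  have cm : c * m = m * c by apply: mc.
  have -> : k * c = m * c * m by rewrite -mulrA cm mulrA -km.
  by apply: pos_mul_mul.
have cn : nrm c <= 1.
  rewrite -(ler_pXn2r (n := 2)) ?nnegrE ?nrm_ge0// expr1n.
  by apply: nrm_sqr_le_of_pos => //; rewrite scale1r cs cc; apply: posD.
(* Since 2 k c = 1 - c^2, this is [nrm_1_sqr]. The size of [k] alone is not controlled as s tends to
   0. *)
have kcn : nrm (k * c) <= 2^-1.
  have := nrm_1_sqr cs cn; rewrite cc.
  have -> : k * c + k * c = 2%:C *: (k * c) by rewrite rmorphD /= scalerDl scale1r.
  rewrite nrmZ ger0_norm//; lra.
exists (a * (k * c + k * c)); first by apply/idealMl/idealD; exact: idealMr.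
have -> : a - a * (k * c + k * c) = a * (c * c).
  by rewrite -cc mulrBr mulr1 opprB addrCA subrr addr0.
set q := a * (c * c).
have ccs : star (c * c) = c * c by rewrite starM cs.
pose Y := c * c * ((2 * s)%:C *: (1 : A) + s%:C *: k) * (c * c).
have : nrm (star q * q) <= nrm Y.
  apply: nrm_mono; first exact: pos_starM.
  have E (p S : A) : star p = p ->
      p * S * p - star (a * p) * (a * p) = star p * (S - star a * a) * p.
    by move=> ps; rewrite starM ps; ncring.
  rewrite /Y /q E //.
  exact: pos_conj.
rewrite nrm_star_mul.
have : nrm Y <= 3 * s.
  have -> : Y = (2 * s)%:C *: (c * c * (c * c)) + s%:C *: (c * (k * c) * (c * c)).
    have E (p : A) : k * p = p * k -> p * p * ((2 * s)%:C *: (1 : A) + s%:C *: k) * (p * p) =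
        (2 * s)%:C *: (p * p * (p * p)) + s%:C *: (p * (k * p) * (p * p)).
      by move=> ->; rewrite mulrDr mulrDl !scMr !scMl mulr1 !mulrA.
    exact: E.
  have M1 x y : nrm x <= 1 -> nrm y <= 1 -> nrm (x * y) <= 1.
    by move=> x1 y1; rewrite (le_trans (nrmM _ _))// mulr_ile1 ?nrm_ge0.
  have s20 : 0 < 2 * s by rewrite mulr_gt0.
  rewrite (le_trans (nrmD _ _))// !nrmZ (gtr0_norm s0) (gtr0_norm s20).
  have : nrm (c * c * (c * c)) <= 1 by rewrite !M1.
  have : nrm (c * (k * c) * (c * c)) <= 1 by apply: (M1); apply: (M1) => //; lra.
  nra.
have : 3 * s < e ^+ 2 by have := exprn_gt0 2 e0; rewrite /s; move: (e ^+ 2) => E; lra.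
move=> h1 h2 h3.
rewrite -(ltr_pXn2r (n := 2)) ?nnegrE ?nrm_ge0 ?(ltW e0)//.
exact: le_lt_trans h3 (le_lt_trans h2 h1).
Qed.

End Ideal.

Section Endo.
Variable alpha : star_endomorphism A.

Lemma endo_pos h : pos h -> pos (alpha h).
Proof. by move=> [k ks ->]; exists (alpha k); rewrite -?endo_star ?endoM ?ks. Qed.

Lemma endo1_sa : star (alpha 1) = alpha 1.
Proof. by rewrite -endo_star star1. Qed.

Lemma endo_Ml1 a : alpha 1 * alpha a = alpha a.
Proof. by rewrite -endoM mul1r. Qed.
Lemma endo_Mr1 a : alpha a * alpha 1 = alpha a.
Proof. by rewrite -endoM mulr1. Qed.

Lemma pos_1_endo1 : pos (1 - alpha 1).
Proof.
exists (1 - alpha 1); first by rewrite starB star1 endo1_sa.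
by rewrite mulrBl !mulrBr !mulr1 mul1r endo_Ml1 subrr subr0.
Qed.

(** Applying [alpha] to the positive element |a|^2 - [star a * a] puts |a|^2 alpha(1) in place of
    |a|^2; the missing |a|^2 (1 - alpha(1)) is a nonnegative multiple of a projection. *)
Lemma endo_nrm a : nrm (alpha a) <= nrm a.
Proof.
rewrite -(ler_pXn2r (n := 2)) ?nnegrE ?nrm_ge0//.
apply: nrm_sqr_le_of_pos; first by rewrite exprn_ge0 ?nrm_ge0.
have := endo_pos (pos_nrm_sqr a); rewrite linearB linearZ /= endoM endo_star => h.
rewrite -(subrK (alpha 1) 1) scalerDr -addrA; apply: posD => //.
by apply: posZ; [rewrite exprn_ge0 ?nrm_ge0|exact: pos_1_endo1].
Qed.

(* [g] is twice the positive part of [h - r]; it is killed by [alpha], so [h g]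
   is in [J] and in the kernel of [alpha]. *)
Lemma endo_isometric J a : closed_ideal J -> (forall b, alpha b = 0 -> J b -> b = 0) ->
  J a -> nrm a <= nrm (alpha a).
Proof.
move=> hJ inj Ja; pose h := star a * a; pose r := nrm (alpha a) ^+ 2.
have r0 : 0 <= r by rewrite exprn_ge0 ?nrm_ge0.
have hs : star h = h := sa_starM a.
pose k := h - r%:C *: (1 : A); have ks : star k = k by rewrite /k starB hs starZr star1.
have [w [wp kw wc]] := pos_sqrt (pos_sqr ks).
have ws := pos_sa wp.
have kwc : k * w = w * k by apply: wc; rewrite /comm_with mulrA.
(* Conjugation by [alpha 1] replaces the scalar r by r alpha(1), which makes the element lie in the
   range of [alpha]. *)
have akp : pos (- alpha k).
  have := pos_conj (alpha 1) (pos_nrm_sqr (alpha a)).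
  rewrite endo1_sa mulrBr mulrBl scMr scMl mulr1 endo_Ml1 mulrA -[X in pos (_ - X)]mulrA endo_Mr1.
  by rewrite -endo_star endo_Ml1 -endoM /k linearB linearZ /= opprB.
(* [w] is the absolute value of [k]; both sides are positive square roots of alpha(k)^2. *)
have aw : alpha w = - alpha k.
  apply: pos_sqr_inj => //; first exact: endo_pos.
    by rewrite /comm_with mulrN mulNr -!endoM kwc.
  by rewrite mulrNN -!endoM kw.
pose g := w + k; have gs : star g = g by rewrite /g starD ws ks.
have ag : alpha g = 0 by rewrite /g linearD /= aw addNr.
have hg : h * g = 0.
  by apply: inj; [rewrite endoM ag mulr0|apply: idealMr => //; apply: idealMl].
have kg : k * g = w * g by rewrite /g (mulrDr k w k) (mulrDr w w k) kwc kw addrC.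
have wg : w * g = - (r%:C *: g).
  by rewrite -kg /k mulrBl hg scMl mul1r sub0r.
have gwc : comm_with g w by rewrite /comm_with /g (mulrDl w k w) (mulrDr w w k) kwc.
(* It is positive, but [w g = - r g] makes it equal to - r g^2. *)
have gwg : g * w * g = 0.
  apply: pos_anti; first exact: pos_mul_mul.
  by rewrite -mulrA wg mulrN opprK scMr; apply: posZ => //; exact: pos_sqr.
have g0 : g = 0.
  apply: sa_cube_eq0 => //.
  have kgg : g * (k * g) = 0 by rewrite kg mulrA.
  by rewrite -mulrA {2}/g (mulrDl w k g) mulrDr kgg mulrA gwg addr0.
rewrite -(ler_pXn2r (n := 2)) ?nnegrE ?nrm_ge0//.
apply: nrm_sqr_le_of_pos => //.
rewrite -/r -/h -opprB -/k; suff -> : - k = w by [].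
by apply/esym/eqP; rewrite -addr_eq0 -/g g0.
Qed.

End Endo.
End IdealsEndomorphisms.

(** * Functionals separating a point from a cone *)

Section ConeSeparation.
Context {R : realType} {E : lmodType R[i]}.
Variables (C : set E) (e h : E) (s0 : R).
Implicit Types (x y : E) (r s t : R).
Hypothesis CD : forall x y, C x -> C y -> C (x + y).
Hypothesis CZ : forall r x, 0 <= r -> C x -> C (r%:C *: x).
Hypothesis Ce : C e.
Hypothesis Cunit : forall x, exists s, C (s%:C *: e - x).
Hypothesis s0_gt0 : 0 < s0.
Hypothesis hC : ~ C (s0%:C *: e - h).

Definition is_cone (X : set E) := [/\ forall x y, X x -> X y -> X (x + y),
  forall r x, 0 <= r -> X x -> X (r%:C *: x) & ~ X (- e)].

(** Adjoining h - s0 e forces a functional that is nonnegative on the cone and 1 at [e] to be at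
    least s0 at [h]. *)
Let C' : set E := [set x | exists c t, [/\ C c, 0 <= t & x = c + t%:C *: (h - s0%:C *: e)]].

Let C0 : C 0.
Proof. by rewrite -(scale0r e) -[0]/(0%:C); apply: CZ. Qed.

Let subCC' : C `<=` C'.
Proof. by move=> c Cc; exists c, 0; rewrite scale0r addr0. Qed.

Let C'_cone : is_cone C'.
Proof.
split.
- move=> _ _ [c [t [Cc t0 ->]]] [d [u [Cd u0 ->]]]; exists (c + d), (t + u); split.
  + exact: CD.
  + exact: addr_ge0.
  + by rewrite rmorphD scalerDl addrACA.
- move=> r _ r0 [c [t [Cc t0 ->]]]; exists (r%:C *: c), (r * t); split.
  + exact: CZ.
  + exact: mulr_ge0.
  + by rewrite rmorphM -scalerA scalerDr.
- move=> [c [t [Cc t0 ce]]].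
  have Cem : ~ C (- e).
    move=> Cm; have [s Cs] := Cunit h; apply: hC.
    have [ss|/ltW ss] := leP s s0.
      rewrite -(subrK s s0) rmorphD scalerDl -addrA; apply: CD => //.
      by apply: CZ => //; rewrite subr_ge0.
    rewrite -(subKr s s0) rmorphB scalerBl addrAC -scalerN; apply: CD => //.
    by apply: CZ => //; rewrite subr_ge0.
  have [t00|t_neq0] := eqVneq t 0.
    by apply: Cem; rewrite ce t00 scale0r addr0.
  have tp : 0 < t by rewrite lt_neqAle eq_sym t_neq0.
  apply: hC; rewrite -(opprB h) -[h - _]scale1r.
  have -> : (1 : R[i]) = (t^-1)%:C * t%:C by rewrite -rmorphM mulVf.
  rewrite -scalerA -scalerN; apply: CZ; first by rewrite invr_ge0.
  have -> : - (t%:C *: (h - s0%:C *: e)) = c + e.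
    by apply/eqP; rewrite eq_sym -subr_eq0 opprK addrAC -ce addNr.
  exact: CD.
Qed.

Lemma max_cone : exists M, [/\ is_cone M, C' `<=` M &
  forall N, is_cone N -> M `<=` N -> N `<=` M].
Proof.
(* Zorn's lemma is applied to the sets X added to [C'], rather than to the cones containing [C'], so
   that the empty chain, whose union is empty, causes no trouble. *)
pose P := [set X | is_cone (C' `|` X)].
have [F FP Ftot|A [PA Amax]] := @Zorn_bigcup E P.
  have pick x y : (C' `|` \bigcup_(X in F) X) x -> (C' `|` \bigcup_(X in F) X) y ->
      exists X, [/\ is_cone (C' `|` X), (C' `|` X) `<=` (C' `|` \bigcup_(X in F) X),
        (C' `|` X) x & (C' `|` X) y].
    have sub X : F X -> (C' `|` X) `<=` (C' `|` \bigcup_(X in F) X).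
      by move=> FX z [?|Xz]; [left|right; exists X].
    move=> [Cx|[X FX Xx]] [Cy|[Y FY Yy]].
    - exists set0; split; [by rewrite setU0|by move=> z [?|[]]; left|by left|by left].
    - by exists Y; split; [exact: FP|exact: sub|left|right].
    - by exists X; split; [exact: FP|exact: sub|right|left].
    - have [XY|YX] := Ftot X Y FX FY.
        by exists Y; split; [exact: FP|exact: sub|right; exact: XY|right].
      by exists X; split; [exact: FP|exact: sub|right|right; exact: YX].
  split.
  - move=> x y ux uy; have [X [[XD _ _] XF Xx Xy]] := pick x y ux uy.
    by apply/XF/XD.
  - move=> r x r0 ux; have [X [[_ XZ _] XF Xx _]] := pick x x ux ux.
    by apply/XF/XZ.
  - move=> u; have [X [[_ _ Xe] _ ux _]] := pick _ _ u u; exact: (Xe ux).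
exists (C' `|` A); split; [exact: PA|by move=> x ?; left|].
move=> N Ncone sub; apply: contrapT => nsub; apply: (Amax N).
  split; first by move=> x Ax; apply: sub; right.
  by move=> NA; apply: nsub => x /NA; right.
rewrite /P /=; suff -> : C' `|` N = N by [].
by apply: setUidr => x C'x; apply: sub; left.
Qed.

(** A maximal cone [M] avoiding -e contains x or -x for every x: otherwise adjoining x would give -e
    = m + t x, hence -x in [M]. So {s | x - s e in M} is a cut of the real line, and its supremum is
    additive in x. *)
Lemma cone_functional : exists phi : E -> R,
  [/\ {morph phi : x y / x + y}, forall r x, phi (r%:C *: x) = r * phi x,
    forall x, C x -> 0 <= phi x & 0 < phi h].
Proof.
have [M [[MD MZ Me] CM Mmax]] := max_cone.
have M_C : C `<=` M by move=> x /subCC' /CM.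
have M1 : M e by apply: M_C.
have Mtot x : ~ M x -> M (- x).
  move=> nMx; pose N := [set y | exists m t, [/\ M m, 0 <= t & y = m + t%:C *: x]].
  have [Ne|Ne] := pselect (N (- e)); last first.
    exfalso; apply: nMx; apply: (Mmax N); last first.
    - by exists 0, 1; split => //; [exact: M_C|rewrite scale1r add0r].
    - by move=> m Mm; exists m, 0; rewrite scale0r addr0.
    split=> //.
    - move=> _ _ [c [t [Cc t0 ->]]] [d [u [Cd u0 ->]]]; exists (c + d), (t + u); split.
      + exact: MD.
      + exact: addr_ge0.
      + by rewrite rmorphD scalerDl addrACA.
    - move=> r _ r0 [c [t [Cc t0 ->]]]; exists (r%:C *: c), (r * t); split.
      + exact: MZ.
      + exact: mulr_ge0.
      + by rewrite rmorphM -scalerA scalerDr.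
  have [m [t [Mm t0 em]]] := Ne.
  have [t00|t_neq0] := eqVneq t 0.
    by exfalso; apply: Me; rewrite em t00 scale0r addr0.
  have tp : 0 < t by rewrite lt_neqAle eq_sym t_neq0.
  rewrite -[x]scale1r.
  have -> : (1 : R[i]) = (t^-1)%:C * t%:C by rewrite -rmorphM mulVf.
  rewrite -scalerA -scalerN; apply: MZ; first by rewrite invr_ge0.
  have -> : - (t%:C *: x) = m + e.
    by apply/eqP; rewrite eq_sym -subr_eq0 opprK addrAC -em addNr.
  exact: MD.
pose S x := [set s | M (x - s%:C *: e)].
have Sub x s t : M (x - s%:C *: e) -> M (t%:C *: e - x) -> s <= t.
  move=> h1 h2; rewrite leNgt; apply/negP => ts; apply: Me.
  have := MD _ _ h1 h2; rewrite [X in M X]addrC subrKA -scalerBl -rmorphB => h3.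
  have st : 0 < s - t by rewrite subr_gt0.
  have := MZ (s - t)^-1 _ _ h3; rewrite scalerA -rmorphM /=.
  rewrite -(opprB s) mulrN mulVf ?gt_eqF// rmorphN /= scaleN1r; apply.
  by rewrite invr_ge0 ltW.
have S0 x : S x !=set0.
  by have [s Cs] := Cunit (- x); exists (- s); rewrite /S /= rmorphN scaleNr opprK addrC -[x]opprK; apply: M_C.
have Sbnd x : has_ubound (S x).
  by have [t Ct] := Cunit x; exists t => s Ss; apply: (Sub x) => //; apply: M_C.
pose phi x := sup (S x).
have phi_ge x s : M (x - s%:C *: e) -> s <= phi x.
  by move=> Ms; apply: ub_le_sup.
have phi_le x t : M (t%:C *: e - x) -> phi x <= t.
  by move=> Mt; apply: ge_sup => // s Ss; exact: Sub Ss Mt.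
have phi_lt x s : s < phi x -> M (x - s%:C *: e).
  move=> /(sup_gt (S0 x))[t St ts].
  rewrite -(subrK (t%:C *: e) x) -addrA -scalerBl -rmorphB; apply: MD => //.
  by apply: MZ => //; rewrite subr_ge0 ltW.
have phi_gt x s : phi x < s -> M (s%:C *: e - x).
  move=> xs; rewrite -opprB; apply: Mtot => /phi_ge; apply/negP; by rewrite -ltNge.
have phiD : {morph phi : x y / x + y}.
  move=> x y; apply/le_anti/andP; split.
    apply/ler_addgt0Pr => eps eps0; apply: phi_le.
    have -> : phi x + phi y + eps = (phi x + eps / 2) + (phi y + eps / 2) by field.
    rewrite rmorphD scalerDl opprD addrACA.
    by apply: MD; apply: phi_gt; rewrite ltrDl divr_gt0.
  apply/ler_addgt0Pr => eps eps0; rewrite -lerBlDr; apply: phi_ge.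
  have -> : phi x + phi y - eps = (phi x - eps / 2) + (phi y - eps / 2) by field.
  rewrite rmorphD scalerDl opprD addrACA.
  by apply: MD; apply: phi_lt; rewrite gtrBl divr_gt0.
have phi0 : phi 0 = 0 by apply: (addrI (phi 0)); rewrite -phiD !addr0.
have phiN x : phi (- x) = - phi x.
  by apply/eqP; rewrite -addr_eq0 -phiD addNr phi0.
have phiZ_le r x : 0 < r -> phi (r%:C *: x) <= r * phi x.
  move=> r0; apply/ler_addgt0Pr => eps eps0; apply: phi_le.
  have -> : r * phi x + eps = r * (phi x + eps / r) by field; rewrite gt_eqF.
  rewrite rmorphM -scalerA -scalerBr; apply: MZ; first exact: ltW.
  by apply: phi_gt; rewrite ltrDl divr_gt0.
have phiZ r x : 0 < r -> phi (r%:C *: x) = r * phi x.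
  move=> r0; apply/le_anti; rewrite phiZ_le//=.
  rewrite mulrC -ler_pdivlMr// mulrC.
  have rx : x = (r^-1)%:C *: (r%:C *: x) by rewrite scalerA -rmorphM mulVf ?gt_eqF// scale1r.
  by rewrite {1}rx; apply: phiZ_le; rewrite invr_gt0.
exists phi; split => //.
- move=> r x; have [r0|r0|->] := ltgtP r 0; last by rewrite scale0r mul0r phi0.
  + rewrite -[r]opprK rmorphN scaleNr phiN phiZ ?mulNr//; lra.
  + exact: phiZ.
- by move=> x Cx; apply: phi_ge; rewrite scale0r subr0; apply: M_C.
- apply: (lt_le_trans s0_gt0); apply: phi_ge; apply: CM.
  by exists 0, 1; rewrite scale1r add0r.
Qed.

End ConeSeparation.

(** * Bounded sequences *)

Section ComplexFacts.
Context {R : realType}.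
Implicit Types (k : R[i]) (r : R).

Lemma conj_rc r : (r%:C : R[i])^* = r%:C.
Proof. by apply/CrealP/complex_realP; exists r. Qed.

Lemma crect k : k = (complex.Re k)%:C + 'i * (complex.Im k)%:C.
Proof. by rewrite [LHS]complexE complexiE. Qed.

Lemma mulii : 'i * 'i = -1 :> R[i].
Proof. by rewrite -expr2 sqrCi. Qed.

End ComplexFacts.

Section BoundedSequences.
Context {R : realType} {A : cstarAlgType R}.
Implicit Types (a b z : A) (r s t : R).

Definition bounded_seq : {pred nat -> A} :=
  [pred X : nat -> A | `[< exists M : R, forall n, nrm (X n) <= M >]].

Record bseq := BSeq { bseq_fun :> nat -> A; bseq_funP : bseq_fun \in bounded_seq }.

HB.instance Definition _ := [isSub for bseq_fun].
HB.instance Definition _ := [Choice of bseq by <:].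

Lemma bseq_ext (X Y : bseq) : X =1 Y -> X = Y.
Proof. by move=> /funext/val_inj. Qed.

Lemma bseq_bound (X : bseq) : exists M : R, forall n, nrm (X n) <= M.
Proof. by have /asboolP := bseq_funP X. Qed.

Lemma bounded_seq_submod : submod_closed bounded_seq.
Proof.
split=> [|k X Y /asboolP[M XM] /asboolP[N YN]]; apply/asboolP.
  by exists 0 => n; rewrite nrm0.
exists (complex.Re `|k| * M + N) => n; rewrite !fctE (le_trans (nrmD _ _))// lerD//.
have kE : (complex.Re `|k|)%:C = `|k| by rewrite RRe_real// normr_real.
have k0 : 0 <= complex.Re `|k| by rewrite -ler0c kE.
apply: le_trans (ler_wpM2l k0 (XM n)).
by rewrite -lecR rmorphM /= kE !nrmE normrZ.
Qed.

HB.instance Definition _ :=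
  GRing.isSubmodClosed.Build R[i] (nat -> A) bounded_seq bounded_seq_submod.
HB.instance Definition _ := [SubChoice_isSubLmodule of bseq by <:].

Implicit Types X Y : bseq.

Lemma bseqD (X Y : bseq) n : (X + Y) n = X n + Y n. Proof. by []. Qed.
Lemma bseqN (X : bseq) n : (- X) n = - X n. Proof. by []. Qed.
Lemma bseqZ (k : R[i]) (X : bseq) n : (k *: X) n = k *: X n. Proof. by []. Qed.
Lemma bmul_subproof (X Y : bseq) : (fun n => X n * Y n) \in bounded_seq.
Proof.
have [M XM] := bseq_bound X; have [N YN] := bseq_bound Y.
apply/asboolP; exists (M * N) => n; rewrite (le_trans (nrmM _ _))//.
by apply: ler_pM; rewrite ?nrm_ge0.
Qed.
Definition bmul X Y := BSeq (bmul_subproof X Y).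

Lemma bmulE X Y n : bmul X Y n = X n * Y n. Proof. by []. Qed.

Lemma bstar_subproof (X : bseq) : (fun n => star (X n)) \in bounded_seq.
Proof.
by have [M XM] := bseq_bound X; apply/asboolP; exists M => n; rewrite nrm_star.
Qed.
Definition bstar X := BSeq (bstar_subproof X).

Lemma bstarE X n : bstar X n = star (X n). Proof. by []. Qed.

Lemma bdelta_subproof m a : (fun n => if n == m then a else 0) \in bounded_seq.
Proof.
apply/asboolP; exists (nrm a) => n; case: ifP => _ //.
by rewrite nrm0 nrm_ge0.
Qed.
Definition bdelta m a := BSeq (bdelta_subproof m a).

Lemma bdeltaE m a n : bdelta m a n = if n == m then a else 0. Proof. by []. Qed.

Lemma bone_subproof : (fun=> 1) \in bounded_seq.
Proof. by apply/asboolP; exists 1 => n; exact: nrm1_le1. Qed.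
Definition bone := BSeq bone_subproof.

Lemma boneE n : bone n = 1. Proof. by []. Qed.

Variable J : set A.
Hypothesis hJ : closed_ideal J.

Record pos_functional (Phi : bseq -> R[i]) : Prop := PosFunctional {
  pf_linear : forall k X Y, Phi (k *: X + Y) = k * Phi X + Phi Y;
  pf_star : forall X, Phi (bstar X) = (Phi X)^*;
  pf_ge0 : forall X, 0 <= Phi (bmul (bstar X) X);
  pf_delta : forall n z, J z -> star z = z -> Phi (bdelta n z) = 0 }.

Lemma pos_functional0 Phi : pos_functional Phi -> Phi 0 = 0.
Proof.
move=> /pf_linear/(_ (-1) 0 0); rewrite scaler0 addr0 mulN1r.
by rewrite addNr.
Qed.

Definition fin_ideal_seq (Z : nat -> A) :=
  [/\ exists N, forall n, (N <= n)%N -> Z n = 0, forall n, J (Z n)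
    & forall n, star (Z n) = Z n].

Lemma fin_ideal_seqD W Z : fin_ideal_seq W -> fin_ideal_seq Z ->
  fin_ideal_seq (fun n => W n + Z n).
Proof.
move=> [[N WN] WJ Ws] [[M ZM] ZJ Zs]; split.
- exists (maxn N M) => n; rewrite geq_max => /andP[Nn Mn].
  by rewrite WN// ZM// addr0.
- by move=> n; exact: idealD.
- by move=> n; rewrite starD Ws Zs.
Qed.

Lemma fin_ideal_seqZ (r : R) Z : fin_ideal_seq Z -> fin_ideal_seq (fun n => r%:C *: Z n).
Proof.
move=> [[M ZM] ZJ Zs]; split.
- by exists M => n /ZM ->; rewrite scaler0.
- by move=> n; exact: idealZ.
- by move=> n; rewrite starZr Zs.
Qed.

Lemma fin_ideal_seq0 : fin_ideal_seq (fun=> 0).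
Proof. by split => [|n|n]; [exists 0%N|exact: ideal0|exact: star0]. Qed.

Lemma fin_ideal_seq_delta m z : J z -> star z = z -> fin_ideal_seq (bdelta m z).
Proof.
move=> Jz zs; split=> [|n|n] /=.
- by exists m.+1 => n mn; rewrite gtn_eqF.
- by case: ifP => _ //; exact: ideal0.
- by case: ifP => _ //; exact: star0.
Qed.

(** Symmetrizing [X] makes this a cone in the whole complex space. It contains X and -X when X is
    skew-adjoint or is a finitely supported self-adjoint sequence in [J], so a functional
    nonnegative on it vanishes there. *)
Definition bcone : set bseq := [set X | exists2 Z, fin_ideal_seq Z &
  forall n, pos (X n + star (X n) + Z n)].

Lemma bconeD X Y : bcone X -> bcone Y -> bcone (X + Y).
Proof.
move=> [Z hZ Xp] [W hW Yp]; exists (fun n => Z n + W n); first exact: fin_ideal_seqD.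
move=> n; rewrite bseqD starD.
have -> : X n + Y n + (star (X n) + star (Y n)) + (Z n + W n) =
  (X n + star (X n) + Z n) + (Y n + star (Y n) + W n) by ncring.
exact: posD.
Qed.

Lemma bconeZ r X : 0 <= r -> bcone X -> bcone (r%:C *: X).
Proof.
move=> r0 [Z hZ Xp]; exists (fun n => r%:C *: Z n); first exact: fin_ideal_seqZ.
by move=> n; rewrite bseqZ starZr -!scalerDr; apply: posZ.
Qed.

Lemma bcone_pos X : (forall n, pos (X n)) -> bcone X.
Proof.
move=> Xp; exists (fun=> 0); first exact: fin_ideal_seq0.
by move=> n; rewrite addr0; apply: posD => //; rewrite pos_sa.
Qed.

Lemma bcone_skew X : (forall n, star (X n) = - X n) -> bcone X.
Proof.
move=> Xp; exists (fun=> 0); first exact: fin_ideal_seq0.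
by move=> n; rewrite Xp subrr addr0; exact: pos0.
Qed.

Lemma bcone_fin X : fin_ideal_seq X -> bcone X.
Proof.
move=> hX; exists (fun n => (-1)%:C *: (X n + X n)).
  by apply: fin_ideal_seqZ; exact: fin_ideal_seqD.
move=> n; have [_ _ ->] := hX.
by rewrite rmorphN1 scaleN1r subrr; exact: pos0.
Qed.

Lemma bcone_unit X : exists s, bcone (s%:C *: bone - X).
Proof.
have [M XM] := bseq_bound X; exists M; exists (fun=> 0); first exact: fin_ideal_seq0.
move=> n; rewrite addr0 bseqD bseqN bseqZ /= starB starZr star1 addrACA.
rewrite -scalerDl -rmorphD -opprD; apply: sa_nrm_pos.
  by rewrite starD starK addrC.
by rewrite (le_trans (nrmD _ _))// nrm_star lerD.
Qed.

(** By contraposition: if s - h lay outside [bcone], the real functional separating it from the cone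
    would complexify to a [Phi] with Phi(h) > 0. *)
Lemma separating_functional (h : bseq) : (forall n, star (h n) = h n) ->
  (forall Phi, pos_functional Phi -> Phi h = 0) ->
  forall s, 0 < s -> exists2 Z, fin_ideal_seq Z &
    forall n, pos (s%:C *: (1 : A) + Z n - h n).
Proof.
move=> hs hPhi s s0; have [|nC] := pselect (bcone (s%:C *: bone - h)).
  (* Membership in [bcone] speaks of X + [star X], which doubles a self-adjoint [X]; hence the
     factor 1/2. *)
  move=> [Z hZ Zp]; exists (fun n => (2^-1)%:C *: Z n); first exact: fin_ideal_seqZ.
  move=> n; have := Zp n; rewrite bseqD bseqN bseqZ /= starB starZr star1 hs.
  move=> /(posZ (r := 2^-1)); rewrite invr_ge0 ler0n => /(_ isT).
  rewrite 2!scalerDr -scalerDl -rmorphD /= (_ : 2^-1 + 2^-1 = 1); last by field.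
  by rewrite scale1r addrAC.
have [phi [phiD phiZ phi_ge phih]] := cone_functional bconeD bconeZ
  (@bcone_pos bone (fun=> pos1)) bcone_unit s0 nC.
have phi0 : phi 0 = 0 by apply: (addrI (phi 0)); rewrite -phiD !addr0.
have phiN x : phi (- x) = - phi x.
  by apply/eqP; rewrite -addr_eq0 -phiD addNr phi0.
have phi_eq0 X : bcone X -> bcone (- X) -> phi X = 0.
  by move=> /phi_ge X0 /phi_ge; rewrite phiN oppr_ge0 => X0'; apply/le_anti; rewrite X0 X0'.
have phi_skew X : (forall n, star (X n) = - X n) -> phi X = 0.
  move=> Xs; apply: phi_eq0; apply: bcone_skew => // n.
  by rewrite bseqN starN Xs.
have phi_star X : phi (bstar X) = phi X.
  apply/eqP; rewrite -subr_eq0 -phiN -phiD; apply/eqP/phi_skew => n.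
  by rewrite bseqD bseqN /= starB starK opprB.
(* The complex-linear functional with real part [phi]. It is real on self-adjoint sequences because
   [phi] kills skew-adjoint ones. *)
pose Phi X : R[i] := (phi X)%:C - 'i * (phi ('i *: X))%:C.
have phi_i X : phi ('i *: ('i *: X)) = - phi X.
  by rewrite scalerA mulii scaleN1r phiN.
have sa_i X : (forall n, star (X n) = X n) -> phi ('i *: X) = 0.
  by move=> Xs; apply: phi_skew => n; rewrite bseqZ starZi Xs.
have PhiP : pos_functional Phi.
  split.
  - move=> k X Y; set a := complex.Re k; set b := complex.Im k.
    have E Z : (k *: Z : bseq) = a%:C *: Z + b%:C *: ('i *: Z).
      by rewrite [in LHS](crect k) scalerDl mulrC !scalerA.
    have E1 : phi (k *: X + Y) = a * phi X + b * phi ('i *: X) + phi Y.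
      by rewrite phiD E phiD !phiZ.
    have E2 : phi ('i *: (k *: X + Y)) = a * phi ('i *: X) - b * phi X + phi ('i *: Y).
      rewrite scalerDr phiD scalerA mulrC -scalerA E phiD !phiZ.
      by rewrite phi_i mulrN.
    rewrite /Phi E1 E2 (crect k) -/a -/b !rmorphD rmorphN !rmorphM /=.
    move: (phi X)%:C (phi Y)%:C (phi ('i *: X))%:C (phi ('i *: Y))%:C a%:C b%:C => p p' q q' u v.
    have h2 := @mulii R.
    transitivity (u * p + v * q + p' - 'i * (u * q + q') + 'i * v * p); first by ring.
    transitivity (u * p - ('i * 'i) * v * q + p' - 'i * (u * q + q') + 'i * v * p); last by ring.
    by rewrite h2; ring.
  - move=> X; rewrite /Phi phi_star rmorphB rmorphM /= conjCi !conj_rc mulNr opprK.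
    have -> : 'i *: bstar X = - (bstar ('i *: X)).
      by apply: bseq_ext => n; rewrite bseqN bseqZ /= starZi opprK.
    by rewrite phiN phi_star rmorphN mulrN opprK.
  - move=> X; have Xs n : star (bmul (bstar X) X n) = bmul (bstar X) X n by exact: sa_starM.
    rewrite /Phi sa_i// mulr0 subr0 ler0c; apply: phi_ge; apply: bcone_pos => n.
    exact: pos_starM.
  - move=> n z Jz zs; have dn := fin_ideal_seq_delta n Jz zs.
    rewrite /Phi sa_i ?mulr0 ?subr0; last by case: dn.
    rewrite phi_eq0//; first exact: bcone_fin.
    have -> : - bdelta n z = bdelta n (- z).
      by apply: bseq_ext => m; rewrite bseqN /=; case: ifP; rewrite ?oppr0.
    apply: bcone_fin; apply: fin_ideal_seq_delta; last by rewrite starN zs.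
    by rewrite -scaleN1r; exact: idealZ.
have := hPhi _ PhiP; rewrite /Phi sa_i// mulr0 subr0 => /complexI ph0.
by rewrite ph0 ltxx in phih.
Qed.

End BoundedSequences.

(** * Semi-inner products and their duals *)

Section ComplexNorm.
Context {R : realType}.
Implicit Types (z w : R[i]) (r : R).

Definition cn z : R := nrm (z : R[i]^o).

Lemma cnE z : (cn z)%:C = `|z|. Proof. by rewrite /cn nrmE. Qed.
Lemma cn_ge0 z : 0 <= cn z. Proof. exact: nrm_ge0. Qed.
Lemma cnD z w : cn (z + w) <= cn z + cn w. Proof. exact: nrmD. Qed.
Lemma cn_distC z w : cn (z - w) = cn (w - z). Proof. exact: nrm_distC. Qed.
Lemma cnN z : cn (- z) = cn z. Proof. exact: nrmN. Qed.
Lemma cn0 : cn 0 = 0. Proof. exact: (@nrm0 R R[i]^o). Qed.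
Lemma cnM z w : cn (z * w) = cn z * cn w.
Proof. by apply: complexI; rewrite rmorphM /= !cnE normrM. Qed.
Lemma cn_conj z : cn (z^*) = cn z.
Proof. by apply: complexI; rewrite !cnE norm_conjC. Qed.
Lemma cn_real r : cn (r%:C) = `|r|.
Proof. by apply: complexI; rewrite cnE normc_def /= expr0n addr0 sqrtr_sqr. Qed.
Lemma cn_sqr z : cn z ^+ 2 = complex.Re z ^+ 2 + complex.Im z ^+ 2.
Proof.
have -> : cn z = Num.sqrt (complex.Re z ^+ 2 + complex.Im z ^+ 2).
  by apply: complexI; rewrite cnE normc_def.
by rewrite sqr_sqrtr// addr_ge0 ?sqr_ge0.
Qed.
Lemma cn_sqrE z : (cn z ^+ 2)%:C = z * z^*.
Proof. by rewrite rmorphXn /= cnE normCK. Qed.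
Lemma Re_le_cn z : complex.Re z <= cn z.
Proof.
have [z0|z0] := leP (complex.Re z) 0; first exact: le_trans z0 (cn_ge0 z).
rewrite -(ler_pXn2r (n := 2)) ?nnegrE ?cn_ge0 ?(ltW z0)// cn_sqr.
by rewrite lerDl sqr_ge0.
Qed.
Lemma Im_le_cn z : `|complex.Im z| <= cn z.
Proof.
rewrite -(ler_pXn2r (n := 2)) ?nnegrE ?cn_ge0// cn_sqr.
by rewrite real_normK ?num_real// lerDr sqr_ge0.
Qed.
Lemma cn_eps z w : (forall e, 0 < e -> cn (z - w) <= e) -> z = w.
Proof. by move=> h; apply/eqP; rewrite -subr_eq0; apply/eqP/(@nrm_eps0 R R[i]^o). Qed.
Lemma cnD_sqr z w : cn (z + w) ^+ 2 <= 2 * cn z ^+ 2 + 2 * cn w ^+ 2.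
Proof.
have := cnD z w; have := cn_ge0 z; have := cn_ge0 w; have := cn_ge0 (z + w).
move: (cn (z + w)) (cn z) (cn w) => a b c a0 c0 b0 abc.
have : a ^+ 2 <= (b + c) ^+ 2 by rewrite ler_pXn2r// nnegrE addr_ge0.
have := sqr_ge0 (b - c); nra.
Qed.
Lemma cn_le_of_sqr z e : 0 < e -> cn z ^+ 2 <= e ^+ 2 -> cn z <= e.
Proof. by move=> e0; rewrite ler_pXn2r ?nnegrE ?cn_ge0 ?(ltW e0). Qed.

Lemma real_complete_seq (u : nat -> R) :
  (forall e : R, 0 < e -> exists N, forall n m, (N <= n)%N -> (N <= m)%N ->
     `|u n - u m| < e) ->
  exists l, forall e : R, 0 < e -> exists N, forall n, (N <= n)%N -> `|u n - l| < e.
Proof.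
move=> h.
have : cauchy (u @ \oo).
  apply/cauchy_exP => e e0; have [N hN] := h e e0.
  by exists (u N); exists N => // n /= Nn; rewrite -ball_normE /= hN.
move=> /cauchy_cvg/cvg_ex[l ul]; exists l => e e0.
have [N _ hN] : (u @ \oo) (ball l e) by apply: ul; exact: nbhsx_ballx.
by exists N => n Nn; have := hN n Nn; rewrite -ball_normE /= distrC.
Qed.

Lemma complex_complete_seq (u : nat -> R[i]) :
  (forall e : R, 0 < e -> exists N, forall n m, (N <= n)%N -> (N <= m)%N ->
     cn (u n - u m) < e) ->
  exists l, forall e : R, 0 < e -> exists N, forall n, (N <= n)%N -> cn (u n - l) < e.
Proof.
move=> h.
have [|a ha] := @real_complete_seq (fun n => complex.Re (u n)).
  move=> e /h[N hN]; exists N => n m Nn Nm; apply: le_lt_trans (hN n m Nn Nm).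
  rewrite -(ler_pXn2r (n := 2)) ?nnegrE ?cn_ge0// cn_sqr raddfB /=.
  by rewrite real_normK ?num_real// lerDl sqr_ge0.
have [|b hb] := @real_complete_seq (fun n => complex.Im (u n)).
  move=> e /h[N hN]; exists N => n m Nn Nm; apply: le_lt_trans (hN n m Nn Nm).
  by rewrite -raddfB Im_le_cn.
exists (a +i* b)%C => e e0.
have [|N hN] := ha (e / 2); first by rewrite divr_gt0.
have [|M hM] := hb (e / 2); first by rewrite divr_gt0.
exists (maxn N M) => n; rewrite geq_max => /andP[/hN h1 /hM h2].
rewrite -(ltr_pXn2r (n := 2)) ?nnegrE ?cn_ge0 ?(ltW e0)// cn_sqr !raddfB /=.
have sq_lt (x : R) : `|x| < e / 2 -> x ^+ 2 < (e / 2) ^+ 2.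
  by move=> xe; rewrite -real_normK ?num_real// ltr_pXn2r ?nnegrE ?divr_ge0 ?(ltW e0).
have := sq_lt _ h1; have := sq_lt _ h2.
have : 0 < e ^+ 2 by rewrite exprn_gt0.
have -> : (e / 2) ^+ 2 = e ^+ 2 / 4 by field.
lra.
Qed.

End ComplexNorm.

Section SemiInner.
Context {R : realType}.

Record semi_inner (V : lmodType R[i]) := SemiInner {
  si_form :> V -> V -> R[i];
  si_lin : forall k x y z, si_form (k *: x + y) z = k * si_form x z + si_form y z;
  si_sym : forall x y, si_form y x = (si_form x y)^*;
  si_ge0 : forall x, 0 <= si_form x x }.

Context {V : lmodType R[i]} (F : semi_inner V).
Implicit Types (x y z : V) (k : R[i]) (r : R).

Definition sq x : R := complex.Re (F x x).

Lemma sqE x : (sq x)%:C = F x x.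
Proof. by rewrite /sq RRe_real// ger0_real// si_ge0. Qed.

Lemma sq_ge0 x : 0 <= sq x.
Proof. by rewrite -ler0c sqE si_ge0. Qed.

Lemma si_linr k x y z : F z (k *: x + y) = k^* * F z x + F z y.
Proof. by rewrite si_sym si_lin rmorphD rmorphM /= -!si_sym. Qed.

Lemma si0l z : F 0 z = 0.
Proof. by have := si_lin F (-1) 0 0 z; rewrite scaler0 addr0 mulN1r addNr. Qed.
Lemma siDl x y z : F (x + y) z = F x z + F y z.
Proof. by rewrite -[x]scale1r si_lin mul1r scale1r. Qed.
Lemma siZl k x z : F (k *: x) z = k * F x z.
Proof. by rewrite -[k *: x]addr0 si_lin si0l addr0. Qed.
Lemma siNl x z : F (- x) z = - F x z.
Proof. by rewrite -scaleN1r siZl mulN1r. Qed.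
Lemma siBl x y z : F (x - y) z = F x z - F y z.
Proof. by rewrite siDl siNl. Qed.
Lemma siDr x y z : F z (x + y) = F z x + F z y.
Proof. by rewrite si_sym siDl rmorphD /= -!si_sym. Qed.
Lemma siZr k x z : F z (k *: x) = k^* * F z x.
Proof. by rewrite si_sym siZl rmorphM /= -!si_sym. Qed.
Lemma siNr x z : F z (- x) = - F z x.
Proof. by rewrite si_sym siNl rmorphN /= -!si_sym. Qed.
Lemma siBr x y z : F z (x - y) = F z x - F z y.
Proof. by rewrite siDr siNr. Qed.

Lemma sqD x y : sq (x + y) = sq x + sq y + 2 * complex.Re (F x y).
Proof.
rewrite /sq siDl !siDr !raddfD /= (si_sym F x y).
have -> (z : R[i]) : complex.Re (z^*) = complex.Re z by case: z.
by ring.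
Qed.

Lemma sqZ k x : sq (k *: x) = cn k ^+ 2 * sq x.
Proof. by apply: complexI; rewrite rmorphM /= !sqE cn_sqrE siZl siZr mulrA. Qed.

Lemma si_cauchy_schwarz x y : cn (F x y) ^+ 2 <= sq x * sq y.
Proof.
set b := F x y.
have key t : 0 <= sq x - 2 * t * cn b ^+ 2 + t ^+ 2 * cn b ^+ 2 * sq y.
  have := sq_ge0 (x + (- t%:C * b) *: y).
  rewrite sqD sqZ siZr -/b cnM cnN cn_real.
  have -> : (- t%:C * b)^* * b = (- t * cn b ^+ 2)%:C.
    by rewrite [RHS]rmorphM /= cn_sqrE rmorphM [in LHS]rmorphN /= conj_rc rmorphN /=; ring.
  rewrite exprMn real_normK ?num_real//=; lra.
have [y0|y0] := eqVneq (sq y) 0.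
  rewrite y0 mulr0; rewrite leNgt; apply/negP => b0.
  (* The form may be degenerate. When y is null the quadratic in t is affine, and this t gives it
     the value -1. *)
  have := key ((sq x + 1) / (2 * cn b ^+ 2)); rewrite y0 mulr0 addr0.
  have -> : 2 * ((sq x + 1) / (2 * cn b ^+ 2)) * cn b ^+ 2 = sq x + 1.
    by field; move/lt0r_neq0: b0; rewrite sqrf_eq0.
  lra.
have yp : 0 < sq y by rewrite lt_neqAle eq_sym y0 sq_ge0.
have := key (sq y)^-1.
have -> : sq x - 2 * (sq y)^-1 * cn b ^+ 2 + (sq y)^-1 ^+ 2 * cn b ^+ 2 * sq y =
  sq x - cn b ^+ 2 / sq y by field.
by rewrite subr_ge0 ler_pdivrMr.
Qed.

Lemma sq_triangle x y : Num.sqrt (sq (x + y)) <= Num.sqrt (sq x) + Num.sqrt (sq y).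
Proof.
have a0 := sqrtr_ge0 (sq x); have b0 := sqrtr_ge0 (sq y).
rewrite -(ler_pXn2r (n := 2)) ?nnegrE ?sqrtr_ge0// ?addr_ge0//.
rewrite sqr_sqrtr ?sq_ge0// sqrrD !sqr_sqrtr ?sq_ge0// sqD.
have : complex.Re (F x y) <= Num.sqrt (sq x) * Num.sqrt (sq y).
  rewrite (le_trans (Re_le_cn _))//.
  rewrite -(ler_pXn2r (n := 2)) ?nnegrE ?cn_ge0 ?mulr_ge0//.
  by rewrite exprMn !sqr_sqrtr ?sq_ge0// si_cauchy_schwarz.
rewrite mulr2n; lra.
Qed.

End SemiInner.

(** * Bounded antilinear functionals and their approximate representing vectors *)

Section Dual.
Context {R : realType} {V : lmodType R[i]} (F : semi_inner V).
Implicit Types (x y z : V) (k : R[i]) (r M : R).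

(** [M] bounds the square of the norm, so that no root is taken before the dual is normed. *)
Definition bounded_by M (f : V -> R[i]) := forall x, cn (f x) ^+ 2 <= M * sq F x.

(** Antilinear, so that x -> F x embeds [V] linearly. *)
Definition bounded_antilinear : {pred V -> R[i]^o} :=
  [pred f : V -> R[i]^o | `[< (forall k x y, f (k *: x + y) = k^* * f x + f y) /\
    exists2 M, 0 <= M & bounded_by M f >]].

Record dual := Dual { dual_fun :> V -> R[i]^o; dual_funP : dual_fun \in bounded_antilinear }.

HB.instance Definition _ := [isSub for dual_fun].
HB.instance Definition _ := [Choice of dual by <:].

Lemma dual_ext (f g : dual) : f =1 g -> f = g.
Proof. by move=> /funext/val_inj. Qed.

Lemma dual_antilinear (f : dual) k x y : f (k *: x + y) = k^* * f x + f y.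
Proof. by have /asboolP[] := dual_funP f. Qed.

Lemma dual_bound (f : dual) : exists2 M, 0 <= M & bounded_by M f.
Proof. by have /asboolP[] := dual_funP f. Qed.

Lemma bounded_antilinear_submod : submod_closed bounded_antilinear.
Proof.
split=> [|k f g /asboolP[fl [M M0 fM]] /asboolP[gl [N N0 gN]]]; apply/asboolP; split.
- by move=> l x y; rewrite mulr0 addr0.
- by exists 0 => // x; rewrite cn0 expr0n mul0r.
- move=> l x y; rewrite !fctE fl gl; change (k * (l^* * f x + f y) + (l^* * g x + g y) = l^* * (k * f x + g x) + (k * f y + g y)).
  by ring.
- exists (2 * cn k ^+ 2 * M + 2 * N); first by have := mulr_ge0 (sqr_ge0 (cn k)) M0; lra.
  move=> x; rewrite !fctE; change (cn (k * f x + g x) ^+ 2 <= (2 * cn k ^+ 2 * M + 2 * N) * sq F x).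
  have := cnD_sqr (k * f x) (g x); rewrite cnM exprMn.
  have := gN x; have := ler_wpM2l (sqr_ge0 (cn k)) (fM x); lra.
Qed.

HB.instance Definition _ :=
  GRing.isSubmodClosed.Build R[i] (V -> R[i]^o) bounded_antilinear
    bounded_antilinear_submod.
HB.instance Definition _ := [SubChoice_isSubLmodule of dual by <:].

Implicit Types f g h : dual.

Lemma dualDE f g x : (f + g) x = f x + g x. Proof. by []. Qed.
Lemma dualZE k f x : (k *: f) x = k * f x. Proof. by []. Qed.
Lemma dual0 f : f 0 = 0.
Proof.
have := dual_antilinear f (-1) 0 0; rewrite scaler0 addr0 rmorphN1 mulN1r.
by rewrite addNr.
Qed.
Lemma dualD f x y : f (x + y) = f x + f y.
Proof. by rewrite -[x]scale1r dual_antilinear conjC1 mul1r scale1r. Qed.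
Lemma dualZ f k x : f (k *: x) = k^* * f x.
Proof. by rewrite -[k *: x]addr0 dual_antilinear dual0 addr0. Qed.
Lemma dualN f x : f (- x) = - f x.
Proof. by rewrite -scaleN1r dualZ rmorphN1 mulN1r. Qed.
Lemma dualB f x y : f (x - y) = f x - f y.
Proof. by rewrite dualD dualN. Qed.

Lemma dual_null f x : sq F x = 0 -> f x = 0.
Proof.
move=> x0; have [M M0 /(_ x)] := dual_bound f; rewrite x0 mulr0 => h.
by apply: cn_eps => e e0; rewrite subr0 cn_le_of_sqr// (le_trans h)// exprn_ge0// ltW.
Qed.

Lemma iota_subproof x : (F x : V -> R[i]^o) \in bounded_antilinear.
Proof.
apply/asboolP; split; first by move=> k y z; rewrite si_linr.
by exists (sq F x); [exact: sq_ge0|move=> y; exact: si_cauchy_schwarz].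
Qed.
Definition iota x : dual := Dual (iota_subproof x).

Definition approx (eps : R) (g : V -> R[i]) x := bounded_by eps (fun y => g y - F x y).

(** If f were F x0, then 2 Re f(x) - |x|^2 would be |x0|^2 - |x - x0|^2, largest at x0. In general a
    point within eps of the supremum works: compare it with x + k y for the best scalar k. *)
Lemma approx_exists f eps : 0 < eps -> exists x, approx eps f x.
Proof.
move=> eps0; have [M M0 fM] := dual_bound f.
pose S := [set 2 * complex.Re (f x) - sq F x | x in [set: V]].
have Sub : has_ubound S.
  exists M => _ [x _ <-]; have := fM x; have := Re_le_cn (f x).
  have := cn_ge0 (f x); have := sq_ge0 F x.
  move: (complex.Re _) (cn _) (sq F x) => a b c c0 b0 ab bc.
  suff : 2 * b <= M + c by lra.
  rewrite -(ler_pXn2r (n := 2)) ?nnegrE ?mulr_ge0 ?addr_ge0//.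
  have := sqr_ge0 (M - c); nra.
have S0 : S !=set0 by exists (2 * complex.Re (f 0) - sq F 0), 0.
have [_ [x _ <-] xS] := sup_adherent eps0 (conj S0 Sub).
exists x => y.
set g := f y - F x y.
have key k : 2 * complex.Re (k^* * g) <= eps + cn k ^+ 2 * sq F y.
  have : 2 * complex.Re (f (x + k *: y)) - sq F (x + k *: y) <= sup S.
    by apply: ub_le_sup => //; exists (x + k *: y).
  rewrite dualD dualZ sqD sqZ siZr raddfD /= /g mulrBr raddfB /=; lra.
have [y0|y0] := eqVneq (sq F y) 0.
  rewrite y0 mulr0 leNgt; apply/negP => g0.
  (* This k makes the left-hand side eps + 1, while the right-hand side is eps. *)
  have := key (((eps + 1) / (2 * cn g ^+ 2))%:C * g); rewrite y0 mulr0 addr0.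
  rewrite rmorphM /= conj_rc -mulrA [g^* * g]mulrC -cn_sqrE -rmorphM /=.
  have -> : (eps + 1) / (2 * cn g ^+ 2) * cn g ^+ 2 = (eps + 1) / 2.
    by field; move/lt0r_neq0: g0; rewrite sqrf_eq0.
  lra.
have yp : 0 < sq F y by rewrite lt_neqAle eq_sym y0 sq_ge0.
have := key (((sq F y)^-1)%:C * g).
rewrite rmorphM /= conj_rc -mulrA [g^* * g]mulrC -cn_sqrE -rmorphM /=.
rewrite cnM exprMn cn_real real_normK ?num_real//.
have -> : (sq F y)^-1 ^+ 2 * cn g ^+ 2 * sq F y = (sq F y)^-1 * cn g ^+ 2 by field.
move=> h; rewrite -ler_pdivrMr// [X in X <= _]mulrC; move: h => /=; lra.
Qed.

Lemma approx_sq f M eps x : 0 <= M -> 0 <= eps ->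
  bounded_by M f -> approx eps f x -> sq F x <= 2 * M + 2 * eps.
Proof.
move=> M0 eps0 fM fx.
have h : sq F x ^+ 2 <= (2 * M + 2 * eps) * sq F x.
  have := cnD_sqr (f x) (- (f x - F x x)).
  rewrite opprB addrC subrK cn_distC -sqE cn_real ger0_norm ?sq_ge0//.
  rewrite sqE; have := fM x; have := fx x; lra.
have [->|c0] := eqVneq (sq F x) 0; first by rewrite addr_ge0 ?mulr_ge0.
have cp : 0 < sq F x by rewrite lt_neqAle eq_sym c0 sq_ge0.
by rewrite -(ler_pM2r cp).
Qed.

(** Both estimates are tested on the vector z = x - y itself, which bounds |F z z|^2 by a multiple
    of F z z. *)
Lemma approxB f eps1 eps2 x y : 0 <= eps1 -> 0 <= eps2 -> approx eps1 f x -> approx eps2 f y ->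
  sq F (x - y) <= 2 * (eps1 + eps2).
Proof.
move=> e1 e2 fx fy; set z := x - y.
have h : sq F z ^+ 2 <= 2 * (eps1 + eps2) * sq F z.
  have := cnD_sqr (f z - F y z) (- (f z - F x z)).
  rewrite opprB addrC subrKA -siBl -sqE cn_real ger0_norm ?sq_ge0// (cn_distC (F x z)).
  have := fx z; have := fy z; lra.
have [->|c0] := eqVneq (sq F z) 0; first by rewrite mulr_ge0 ?addr_ge0.
have cp : 0 < sq F z by rewrite lt_neqAle eq_sym c0 sq_ge0.
by rewrite -(ler_pM2r cp).
Qed.

End Dual.

Section DualInner.
Context {R : realType} {V : lmodType R[i]} (F : semi_inner V).
Implicit Types (x y z : V) (k : R[i]) (r M : R) (f g h : dual F).

(* [c] is the inner product of [f] and [g]: up to the constant 4 this is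
   Cauchy-Schwarz for [f] and [g - iota x]. *)
Definition is_inner f g (c : R[i]) := forall M eps x, 0 <= M -> 0 < eps ->
  bounded_by F M f -> approx F eps g x -> cn (c - f x) ^+ 2 <= 4 * (M * eps).

(** The number c is the limit of f along vectors representing g ever better; [approxB] makes these
    values Cauchy. The 4 in [is_inner] is the 2 of [approxB] times the 2 of [cnD_sqr]. *)
Lemma is_inner_exists f g : exists c, is_inner f g c.
Proof.
have e_gt0 n : 0 < (n.+1%:R : R)^-1 by rewrite invr_gt0.
have smallinv (C e : R) : 0 <= C -> 0 < e -> exists N, forall n, (N <= n)%N -> C * (n.+1%:R)^-1 <= e.
  move=> C0 e0; exists (Num.truncn (C / e)) => n Nn.
  rewrite ler_pdivrMr// mulrC -ler_pdivrMr// ltW// (lt_le_trans (truncnS_gt _))//.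
  by rewrite ler_nat.
pose x n := projT1 (cid (approx_exists g (e_gt0 n))).
have xP n : approx F (n.+1%:R)^-1 g (x n) by rewrite /x; case: cid.
have [M M0 fM] := dual_bound f.
have dist N eps n y : 0 <= N -> 0 < eps -> bounded_by F N f -> approx F eps g y ->
    cn (f (x n) - f y) ^+ 2 <= N * (2 * ((n.+1%:R)^-1 + eps)).
  move=> N0 eps0 fN gy; rewrite -dualB (le_trans (fN _))// ler_wpM2l//.
  by apply: approxB (xP n) gy; rewrite ltW.
have [e e0|c hc] := @complex_complete_seq _ (fun n => f (x n)).
  have [||N hN] := smallinv (8 * M) (e ^+ 2); [by rewrite mulr_ge0|exact: exprn_gt0|].
  exists N => n m /hN h1 /hN h2.
  rewrite -(ltr_pXn2r (n := 2)) ?nnegrE ?cn_ge0 ?(ltW e0)//.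
  apply: le_lt_trans (dist _ _ n _ M0 (e_gt0 m) fM (xP m)) _.
  have : 0 < e ^+ 2 by rewrite exprn_gt0.
  move: h1 h2; move: (n.+1%:R^-1) (m.+1%:R^-1) => p q; lra.
exists c => N eps y N0 eps0 fN gy; apply/ler_addgt0Pr => e e0.
have [||n1 h1] := smallinv (4 * N) (e / 2); [by rewrite mulr_ge0|by rewrite divr_gt0|].
pose d := Num.min 1 (e / 4).
have d0 : 0 < d by rewrite lt_min ltr01 divr_gt0.
have dd : d ^+ 2 <= e / 4.
  have d1 : d <= 1 by rewrite ge_min lexx.
  have d2 : d <= e / 4 by rewrite ge_min lexx orbT.
  by rewrite expr2 (le_trans _ d2)// ler_piMr// ltW.
have [n2 h2] := hc d d0.
pose n := maxn n1 n2.
have {}h1 := h1 n (leq_maxl _ _); have {}h2 := h2 n (leq_maxr _ _).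
have {}h2 : cn (c - f (x n)) ^+ 2 <= d ^+ 2.
  by rewrite cn_distC ler_pXn2r ?nnegrE ?cn_ge0 ?(ltW d0) ?(ltW h2).
have := dist _ _ n _ N0 eps0 fN gy.
have := cnD_sqr (c - f (x n)) (f (x n) - f y); rewrite subrKA.
move: h1; move: (n.+1%:R^-1) => p; lra.
Qed.

Definition dual_inner f g : R[i] := projT1 (cid (is_inner_exists f g)).

Lemma dual_innerP f g : is_inner f g (dual_inner f g).
Proof. by rewrite /dual_inner; case: cid. Qed.

Lemma dual_inner_approx f g e : 0 < e -> exists2 eps0, 0 < eps0 &
  forall eps x, 0 < eps <= eps0 -> approx F eps g x -> cn (dual_inner f g - f x) <= e.
Proof.
move=> e0; have [M M0 fM] := dual_bound f.
exists (e ^+ 2 / (4 * (M + 1))).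
  by rewrite divr_gt0 ?exprn_gt0// mulr_gt0// ltr_wpDl.
move=> eps x /andP[eps0]; rewrite ler_pdivlMr ?mulr_gt0 ?ltr_wpDl// => h gx.
apply: cn_le_of_sqr => //; apply: le_trans (dual_innerP M0 eps0 fM gx) _.
by have := ltW eps0; lra.
Qed.

Lemma dual_inner_lin k f f' g : dual_inner (k *: f + f') g = k * dual_inner f g + dual_inner f' g.
Proof.
apply: cn_eps => e e0; have k0 := cn_ge0 k.
pose d := e / (cn k + 2).
have k2 : 0 < cn k + 2 by rewrite ltr_wpDl.
have d0 : 0 < d by rewrite divr_gt0.
have dE : d * (cn k + 2) = e by rewrite /d divfK// gt_eqF.
have [e1 e10 h1] := dual_inner_approx (k *: f + f') g d0.
have [e2 e20 h2] := dual_inner_approx f g d0.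
have [e3 e30 h3] := dual_inner_approx f' g d0.
pose eps := Num.min e1 (Num.min e2 e3).
have eps0 : 0 < eps by rewrite !lt_min e10 e20 e30.
have [x gx] := approx_exists g eps0.
have le1 : eps <= e1 by rewrite ge_min lexx.
have le2 : eps <= e2 by rewrite !ge_min lexx orbT.
have le3 : eps <= e3 by rewrite !ge_min lexx !orbT.
have := h1 eps x; rewrite eps0 le1 => /(_ isT gx).
have := h2 eps x; rewrite eps0 le2 => /(_ isT gx).
have := h3 eps x; rewrite eps0 le3 => /(_ isT gx).
rewrite dualDE dualZE.
set c := dual_inner _ _; set b := dual_inner _ _; set a := dual_inner _ _ => i3 i2 i1.
have -> : a - (k * b + c) = (a - (k * f x + f' x)) + (k * (f x - b) + (f' x - c)) by ring.
rewrite -dE; have := cnD (a - (k * f x + f' x)) (k * (f x - b) + (f' x - c)).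
have := cnD (k * (f x - b)) (f' x - c); rewrite cnM.
rewrite (cn_distC _ b) (cn_distC _ c).
have := ler_wpM2l k0 i2; lra.
Qed.

(** Let x nearly represent f and y nearly represent g. Then (g,f), g(x), F y x, the conjugate of
    f(y) and the conjugate of (f,g) differ successively by at most d = e/4. The bound [e3] absorbs
    the lengths of x and y in the two middle steps. *)
Lemma dual_inner_sym f g : dual_inner g f = (dual_inner f g)^*.
Proof.
apply: cn_eps => e e0; pose d := e / 4; have d0 : 0 < d by rewrite divr_gt0.
have [M M0 fM] := dual_bound f; have [N N0 gN] := dual_bound g.
have [e1 e10 h1] := dual_inner_approx f g d0.
have [e2 e20 h2] := dual_inner_approx g f d0.
pose e3 := d ^+ 2 / (2 * (M + N) + 2).
have MN : 0 < 2 * (M + N) + 2 by lra.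
have e30 : 0 < e3 by rewrite divr_gt0// exprn_gt0.
pose eps := Num.min (Num.min 1 e3) (Num.min e1 e2).
have eps0 : 0 < eps by rewrite !lt_min e10 e20 e30 ltr01.
have le1 : eps <= e1 by rewrite !ge_min lexx !orbT.
have le2 : eps <= e2 by rewrite !ge_min lexx !orbT.
have le3 : eps <= e3 by rewrite !ge_min lexx !orbT.
have le4 : eps <= 1 by rewrite !ge_min lexx.
have [x fx] := approx_exists f eps0; have [y gy] := approx_exists g eps0.
have epsle := ltW eps0.
have i1 : cn (dual_inner f g - f y) <= d by apply: (h1 eps); rewrite ?eps0.
have i2 : cn (dual_inner g f - g x) <= d by apply: (h2 eps); rewrite ?eps0.
have e3E : e3 * (2 * (M + N) + 2) = d ^+ 2 by rewrite /e3 divfK// gt_eqF.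
have qle K : 0 <= K -> K <= M + N -> eps * (2 * K + 2 * eps) <= d ^+ 2.
  move=> K0 KMN; rewrite -e3E; apply: ler_pM => //; last by lra.
  by rewrite addr_ge0 ?mulr_ge0.
have i3 : cn (f y - F x y) <= d.
  apply: cn_le_of_sqr => //; apply: le_trans (fx y) _.
  apply: le_trans (qle N N0 _); last by lra.
  by rewrite ler_wpM2l//; apply: approx_sq gN gy.
have i4 : cn (g x - F y x) <= d.
  apply: cn_le_of_sqr => //; apply: le_trans (gy x) _.
  apply: le_trans (qle M M0 _); last by lra.
  by rewrite ler_wpM2l//; apply: approx_sq fM fx.
set a := dual_inner g f in i2 *; set b := dual_inner f g in i1 *.
have -> : a - b^* = (a - g x) + (g x - F y x) + ((F x y - f y) + (f y - b))^*.
  by rewrite (si_sym F x y) rmorphD !rmorphB /=; ring.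
have := cnD (a - g x + (g x - F y x)) ((F x y - f y + (f y - b))^*).
rewrite cn_conj; have := cnD (a - g x) (g x - F y x).
have := cnD (F x y - f y) (f y - b); rewrite (cn_distC (F x y)) (cn_distC _ b).
have : e = 4 * d by rewrite /d; field.
lra.
Qed.

Lemma dual_inner_iota f x : dual_inner f (iota F x) = f x.
Proof.
apply: cn_eps => e e0; have [e1 e10 h] := dual_inner_approx f (iota F x) e0.
apply: (h e1); first by rewrite e10 lexx.
by move=> y; rewrite /= subrr cn0 expr0n mulr_ge0 ?sq_ge0 ?ltW.
Qed.

Lemma dual_diag_approx f d : 0 < d ->
  exists x, cn (dual_inner f f - f x) <= d /\ cn (F x x - f x) <= d.
Proof.
move=> d0; have [M M0 fM] := dual_bound f.
have [e1 e10 h1] := dual_inner_approx f f d0.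
pose e3 := d ^+ 2 / (2 * M + 2).
have MN : 0 < 2 * M + 2 by lra.
have e30 : 0 < e3 by rewrite divr_gt0// exprn_gt0.
pose eps := Num.min 1 (Num.min e1 e3).
have eps0 : 0 < eps by rewrite !lt_min e10 e30 ltr01.
have le1 : eps <= e1 by rewrite !ge_min lexx !orbT.
have le3 : eps <= e3 by rewrite !ge_min lexx !orbT.
have le4 : eps <= 1 by rewrite !ge_min lexx.
have epsle := ltW eps0.
have [x fx] := approx_exists f eps0.
exists x; split; first by apply: (h1 eps); rewrite ?eps0.
have e3E : e3 * (2 * M + 2) = d ^+ 2 by rewrite /e3 divfK// gt_eqF.
rewrite cn_distC; apply: cn_le_of_sqr => //; apply: le_trans (fx x) _.
rewrite -e3E; apply: ler_pM; rewrite ?sq_ge0//.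
by apply: le_trans (approx_sq M0 epsle fM fx) _; lra.
Qed.

Lemma dual_inner_ge0 f : 0 <= dual_inner f f.
Proof.
set c := dual_inner f f.
have cE : c = (complex.Re c)%:C.
  by rewrite RRe_real//; apply/CrealP; rewrite -dual_inner_sym.
rewrite cE ler0c; apply/ler_addgt0Pl => e e0.
have [|x [i1 i3]] := @dual_diag_approx f (e / 2); first by rewrite divr_gt0.
have := Re_le_cn (F x x - c); have := cnD (F x x - f x) (f x - c).
rewrite subrKA (cn_distC (f x)) raddfB /= -/c in i1 *.
by have := sq_ge0 F x; rewrite /sq; lra.
Qed.

Definition dual_form : semi_inner (dual F) :=
  SemiInner dual_inner_lin (fun f g => dual_inner_sym f g) dual_inner_ge0.

Lemma dual_sharp f y : cn (f y) ^+ 2 <= sq dual_form f * sq F y.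
Proof.
have := si_cauchy_schwarz dual_form f (iota F y).
by rewrite /= dual_inner_iota {2}/sq /= dual_inner_iota.
Qed.

(** With [dual_sharp], this makes the Hilbert norm the operator norm. If N = M + 2d were the square
    norm, a vector x nearly representing f would have a = |f(x)| >= M + d and a^2 <= M (a + d),
    which is impossible. *)
Lemma dual_sq_le f M : 0 <= M -> bounded_by F M f -> sq dual_form f <= M.
Proof.
move=> M0 fM; rewrite leNgt; apply/negP => MN.
set N := sq _ _ in MN; pose d := (N - M) / 2.
have d0 : 0 < d by rewrite divr_gt0// subr_gt0.
have [x [i1 i2]] := dual_diag_approx f d0.
have NE : N%:C = dual_inner f f by rewrite sqE.
have h1 : N <= cn (f x) + d.
  have := cnD (dual_inner f f - f x) (f x).
  rewrite subrK -NE cn_real ger0_norm ?sq_ge0// NE; lra.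
have h2 : sq F x <= cn (f x) + d.
  have := cnD (F x x - f x) (f x).
  rewrite subrK -{1}sqE cn_real ger0_norm ?sq_ge0//; lra.
have := ler_wpM2l M0 h2; have := fM x; rewrite /d in h1 *; move: (cn (f x)) h1 => a; nra.
Qed.

End DualInner.

Section SeqComplete.
Context {R : realType} {W : normedModType R[i]}.

(** A Cauchy filter contains a ball of radius 1/(n+1) for every n; the centres form a Cauchy
    sequence, whose limit is that of the filter. *)
Lemma seq_complete_cvg :
  (forall u : nat -> W,
    (forall e : R, 0 < e -> exists N, forall n m, (N <= n)%N -> (N <= m)%N ->
      nrm (u n - u m) < e) ->
    exists l, forall e : R, 0 < e -> exists N, forall n, (N <= n)%N -> nrm (u n - l) < e) ->
  forall G : set_system W, ProperFilter G -> cauchy G -> cvg G.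
Proof.
move=> seqc G GG Gc.
have e_gt0 n : 0 < ((n.+1%:R : R)^-1)%:C by rewrite ltcR invr_gt0.
have uex n : exists x, G (ball x ((n.+1%:R : R)^-1)%:C).
  by have /cauchyP/(_ _ (e_gt0 n)) := Gc.
pose u n := projT1 (cid (uex n)).
have uP n : G (ball (u n) ((n.+1%:R : R)^-1)%:C) by rewrite /u; case: cid.
have small (e : R) : 0 < e -> exists N, forall n, (N <= n)%N -> (n.+1%:R)^-1 < e.
  move=> e0; exists (Num.truncn e^-1) => n Nn.
  rewrite invf_plt ?posrE// (lt_le_trans (truncnS_gt _))//.
  by rewrite ler_nat.
have [e e0|l hl] := seqc u.
  have [|N hN] := small (e / 2); first by rewrite divr_gt0.
  exists N => n m /hN h1 /hN h2.
  have /filter_ex[z []] : G (ball (u n) ((n.+1%:R : R)^-1)%:C `&` ball (u m) ((m.+1%:R : R)^-1)%:C).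
    exact: filterI.
  rewrite -!ball_normE /= -!nrmE !ltcR (nrm_distC (u m)) => h3 h4.
  have := nrmD (u n - z) (z - u m); rewrite subrKA.
  have := lt_trans h3 h1; have := lt_trans h4 h2; lra.
apply/cvg_ex; exists l => B /nbhs_ballP[e e0 lB].
have eE : (complex.Re e)%:C = e :> R[i] by rewrite RRe_real// gtr0_real.
have e0' : 0 < complex.Re e by rewrite -ltcR eE.
have [|N hN] := small (complex.Re e / 2); first by rewrite divr_gt0.
have [|M hM] := hl (complex.Re e / 2); first by rewrite divr_gt0.
have h1 := hN _ (leq_maxl N M); have h2 := hM _ (leq_maxr N M).
apply: filterS (uP (maxn N M)) => z; rewrite -ball_normE /= -nrmE ltcR => h3.
apply: lB; rewrite -ball_normE /= -nrmE -eE ltcR.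
have := nrmD (l - u (maxn N M)) (u (maxn N M) - z); rewrite subrKA (nrm_distC l (u _)).
have := lt_trans h3 h1; lra.
Qed.

End SeqComplete.

Section DualHilbert.
Context {R : realType} {V : lmodType R[i]} (F : semi_inner V).
Implicit Types (x y z : V) (k : R[i]) (r M : R) (f g h : dual F).

Local Notation I := (dual_form F).

Definition dual_norm f : R[i] := (Num.sqrt (sq I f))%:C.

Lemma dual_norm_triangle f g : dual_norm (f + g) <= dual_norm f + dual_norm g.
Proof. by rewrite /dual_norm -rmorphD lecR sq_triangle. Qed.

Lemma dual_normZ k f : dual_norm (k *: f) = `|k| * dual_norm f.
Proof.
rewrite /dual_norm sqZ sqrtrM ?sqr_ge0// sqrtr_sqr ger0_norm ?cn_ge0//.
by rewrite rmorphM /= cnE.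
Qed.

Lemma dual_norm0 f : dual_norm f = 0 -> f = 0.
Proof.
move=> /(@complexI R _ 0)/eqP; rewrite sqrtr_eq0 => f0; apply: dual_ext => y.
apply: cn_eps => e e0; rewrite subr0 cn_le_of_sqr//.
apply: le_trans (dual_sharp f y) _; apply: le_trans (_ : 0 <= _).
  by rewrite mulr_le0_ge0 ?sq_ge0.
by rewrite exprn_ge0 ?ltW.
Qed.

HB.instance Definition _ := Lmodule_isNormed.Build R[i] (dual F)
  dual_norm_triangle dual_normZ dual_norm0.

Lemma nrm_dual f : nrm f = Num.sqrt (sq I f).
Proof. by apply: complexI; rewrite nrmE. Qed.

Lemma nrm_dual_sqr f : nrm f ^+ 2 = sq I f.
Proof. by rewrite nrm_dual sqr_sqrtr ?sq_ge0. Qed.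

(** The benefit of realizing the completion as a dual: limits are taken pointwise in [R[i]], and
    [dual_sq_le] turns the uniform estimate [unif] into norm convergence. *)
Lemma dual_seq_complete (u : nat -> dual F) :
  (forall e : R, 0 < e -> exists N, forall n m, (N <= n)%N -> (N <= m)%N ->
    nrm (u n - u m) < e) ->
  exists l, forall e : R, 0 < e -> exists N, forall n, (N <= n)%N -> nrm (u n - l) < e.
Proof.
move=> uc.
have eval f y : cn (f y) <= nrm f * Num.sqrt (sq F y).
  rewrite -(ler_pXn2r (n := 2)) ?nnegrE ?cn_ge0 ?mulr_ge0 ?nrm_ge0 ?sqrtr_ge0//.
  by rewrite exprMn nrm_dual_sqr sqr_sqrtr ?sq_ge0// dual_sharp.
have lim_ex y : exists l, forall e : R, 0 < e -> exists N, forall n, (N <= n)%N -> cn (u n y - l) < e.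
  apply: complex_complete_seq => e e0.
  have s0 := sqrtr_ge0 (sq F y).
  have s1 : 0 < Num.sqrt (sq F y) + 1 by lra.
  have [|N hN] := uc (e / (Num.sqrt (sq F y) + 1)); first by rewrite divr_gt0.
  exists N => n m Nn Nm; have := hN n m Nn Nm; rewrite ltr_pdivlMr// => h1.
  have := eval (u n - u m) y; rewrite -[(u n - u m) y]/(u n y - u m y).
  have := nrm_ge0 (u n - u m); lra.
pose f y := projT1 (cid (lim_ex y)).
have fP y e : 0 < e -> exists N, forall n, (N <= n)%N -> cn (u n y - f y) < e.
  by rewrite /f; case: cid => l /= hl /hl.
have unif e : 0 < e -> exists N, forall n, (N <= n)%N -> forall y, cn (u n y - f y) <= e * Num.sqrt (sq F y).
  move=> e0; have [N hN] := uc e e0; exists N => n Nn y.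
  apply/ler_addgt0Pr => d d0; have [M hM] := fP y d d0.
  have h1 := hM _ (leq_maxr N M); have h2 := hN n _ Nn (leq_maxl N M).
  have := eval (u n - u (maxn N M)) y; rewrite -[(u n - u (maxn N M)) y]/(u n y - u (maxn N M) y).
  have := cnD (u n y - u (maxn N M) y) (u (maxn N M) y - f y); rewrite subrKA.
  have := ler_wpM2r (sqrtr_ge0 (sq F y)) (ltW h2); lra.
have fdual : (f : V -> R[i]^o) \in bounded_antilinear F.
  apply/asboolP; split=> [k x y|].
    apply: cn_eps => e e0; have k0 := cn_ge0 k.
    pose d := e / (cn k + 2).
    have k2 : 0 < cn k + 2 by rewrite ltr_wpDl.
    have d0 : 0 < d by rewrite divr_gt0.
    have dE : d * (cn k + 2) = e by rewrite /d divfK// gt_eqF.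
    have [N1 h1] := fP (k *: x + y) d d0.
    have [N2 h2] := fP x d d0.
    have [N3 h3] := fP y d d0.
    pose n := maxn N1 (maxn N2 N3).
    have {}h1 := h1 n (leq_maxl _ _).
    have {}h2 : cn (u n x - f x) < d by apply: h2; rewrite !leq_max leqnn orbT.
    have {}h3 : cn (u n y - f y) < d by apply: h3; rewrite !leq_max leqnn !orbT.
    rewrite dual_antilinear in h1.
    set a := f _ in h1 *; set b := f x in h2 *; set c := f y in h3 *.
    set p : R[i] := u n x in h1 h2; set q : R[i] := u n y in h1 h3.
    change (is_true (cn (a - (k^* * b + c)) <= e)).
    change (is_true (cn (k^* * p + q - a) < d)) in h1.
    have -> : a - (k^* * b + c) = - (k^* * p + q - a) + (k^* * (p - b) + (q - c)) by ring.
    have := cnD (- (k^* * p + q - a)) (k^* * (p - b) + (q - c)).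
    have := cnD (k^* * (p - b)) (q - c); rewrite cnM cn_conj cnN.
    have := ler_wpM2l k0 (ltW h2); lra.
  have [N hN] := unif 1 ltr01; have {}hN := hN N (leqnn N).
  exists (2 * sq I (u N) + 2); first by rewrite addr_ge0 ?mulr_ge0 ?sq_ge0.
  move=> y; have := cnD_sqr (u N y) (- (u N y - f y)).
  rewrite opprB addrC subrK (cn_distC (f y)).
  have := dual_sharp (u N) y.
  have : cn (u N y - f y) ^+ 2 <= sq F y.
    rewrite -[leRHS](sqr_sqrtr (sq_ge0 F y)) ler_pXn2r ?nnegrE ?cn_ge0 ?sqrtr_ge0//.
    by have := hN y; rewrite mul1r.
  lra.
exists (Dual fdual) => e e0; have [|N hN] := unif (e / 2); first by rewrite divr_gt0.
exists N => n /hN h.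
rewrite -(ltr_pXn2r (n := 2)) ?nnegrE ?nrm_ge0 ?(ltW e0)// nrm_dual_sqr.
apply: (@le_lt_trans _ _ ((e / 2) ^+ 2)).
  apply: dual_sq_le; first exact: sqr_ge0.
  move=> y; rewrite -[X in cn X]/(u n y - f y).
  rewrite -[sq F y](sqr_sqrtr (sq_ge0 F y)) -exprMn ler_pXn2r ?nnegrE ?cn_ge0 ?mulr_ge0 ?invr_ge0 ?(ltW e0) ?sqrtr_ge0//.
by have := exprn_gt0 2 e0; rewrite expr_div_n; lra.
Qed.

HB.instance Definition _ := Uniform_isComplete.Build (dual F)
  (seq_complete_cvg dual_seq_complete).

Lemma dual_zmodl g : zmod_morphism (I ^~ g).
Proof. by move=> f f'; rewrite siBl. Qed.
Lemma dual_zmodr g : zmod_morphism (I g).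
Proof. by move=> f f'; rewrite siBr. Qed.
Lemma dual_scalel g : scalable_for *%R (I ^~ g).
Proof. by move=> k f; exact: siZl. Qed.
Lemma dual_scaler g : scalable_for (Num.conj \; *%R) (I g).
Proof. by move=> k f; exact: siZr. Qed.
Lemma dual_herm f g : I f g = (-1) ^+ false * (I g f)^*.
Proof. by rewrite expr0 mul1r -si_sym. Qed.
Lemma dual_pos f : f != 0 -> 0 < I f f.
Proof.
move=> f0; rewrite lt_def si_ge0 andbT; apply: contra_neq f0 => f0.
by apply: dual_norm0; rewrite /dual_norm /sq f0 sqrtr0.
Qed.

HB.instance Definition _ := isBilinear.Build R[i] (dual F) (dual F) R[i]
  *%R (Num.conj \; *%R) (si_form I) dual_zmodl dual_zmodr dual_scalel dual_scaler.
HB.instance Definition _ := isHermitianSesquilinear.Build R[i] (dual F) false Num.conj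
  (si_form I) dual_herm.
HB.instance Definition _ := isDotProduct.Build R[i] (dual F) (si_form I) dual_pos.

Lemma dual_inner_norm f : I f f = `|f| ^+ 2.
Proof. by rewrite -nrmE -rmorphXn /= nrm_dual_sqr sqE. Qed.

HB.instance Definition _ := isHilbert.Build R (dual F)
  (inner := (si_form I : {dot dual F for @Num.conj R[i]})) dual_inner_norm.

End DualHilbert.

(** * Adjointable operators and direct sums *)

Section Lift.
Context {R : realType} {V : lmodType R[i]} (F : semi_inner V).
Implicit Types (x y z : V) (k : R[i]) (r M : R) (f g h : dual F).

(** The adjoint is part of the data because [V] is not complete. Both bounds are recorded: the lift
    of an operator uses that of its adjoint, and the lift of the adjoint uses the other. *)
Record adjop := AdjOp {
  ao_fun :> V -> V;
  ao_adj : V -> V;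
  ao_lin : forall k x y, ao_fun (k *: x + y) = k *: ao_fun x + ao_fun y;
  ao_adj_lin : forall k x y, ao_adj (k *: x + y) = k *: ao_adj x + ao_adj y;
  ao_bound : exists2 M, 0 <= M & forall x, sq F (ao_fun x) <= M * sq F x;
  ao_adj_bound : exists2 M, 0 <= M & forall x, sq F (ao_adj x) <= M * sq F x;
  ao_adjE : forall x y, F (ao_fun x) y = F x (ao_adj y) }.

Lemma ao_adjE' (T : adjop) x y : F (ao_adj T x) y = F x (T y).
Proof. by rewrite [LHS]si_sym -ao_adjE -si_sym. Qed.

Definition ao_flip (T : adjop) : adjop :=
  AdjOp (ao_adj_lin T) (ao_lin T) (ao_adj_bound T) (ao_bound T) (ao_adjE' T).

(** Composing [iota x] with the adjoint gives [iota (T x)], so precomposition extends [T] from [V]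
    to the dual. *)
Lemma lift_fun_subproof (T : adjop) f :
  (fun x => f (ao_adj T x) : R[i]^o) \in bounded_antilinear F.
Proof.
apply/asboolP; split=> [k x y|].
  by rewrite ao_adj_lin dual_antilinear.
have [M M0 TM] := ao_adj_bound T; have [N N0 fN] := dual_bound f.
exists (N * M); first exact: mulr_ge0.
by move=> x; rewrite (le_trans (fN _))// -mulrA ler_wpM2l.
Qed.
Definition lift_fun (T : adjop) f : dual F := Dual (lift_fun_subproof T f).

Lemma lift_subproof (T : adjop) : lift_fun T \in bounded_operator.
Proof.
apply/asboolP; split=> [k f g|]; first by apply: dual_ext => x.
have [M M0 TM] := ao_adj_bound T.
exists (Num.sqrt M)%:C => f; rewrite -!nrmE -rmorphM lecR.
rewrite -(ler_pXn2r (n := 2)) ?nnegrE ?mulr_ge0 ?nrm_ge0 ?sqrtr_ge0//.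
rewrite exprMn !nrm_dual_sqr sqr_sqrtr//; apply: dual_sq_le.
  by rewrite mulr_ge0 ?sq_ge0.
move=> x; rewrite (le_trans (dual_sharp f _))// mulrC mulrAC.
by rewrite ler_wpM2r ?sq_ge0.
Qed.
Definition lift (T : adjop) : bop (dual F) := Bop (lift_subproof T).

Lemma liftE (T : adjop) f x : lift T f x = f (ao_adj T x).
Proof. by []. Qed.

Lemma innerE f g : inner f g = dual_inner f g.
Proof. by []. Qed.

(** If x represents g up to eps, then [ao_adj T x] represents [lift (ao_flip T) g] up to eps (M +
    1). Both inner products are thus close to f([ao_adj T x]). *)
Lemma adjoint_lift (T : adjop) : adjoint (lift T) = lift (ao_flip T).
Proof.
apply: adjoint_unique => f g; rewrite !innerE; apply: cn_eps => e e0.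
have d0 : 0 < e / 2 by rewrite divr_gt0.
have [M M0 TM] := ao_bound T.
have M1 : 0 < M + 1 by rewrite ltr_wpDl.
have [e1 e10 h1] := dual_inner_approx (lift T f) g d0.
have [e2 e20 h2] := dual_inner_approx f (lift (ao_flip T) g) d0.
pose eps := Num.min e1 (e2 / (M + 1)).
have eps0 : 0 < eps by rewrite lt_min e10 divr_gt0.
have le1 : eps <= e1 by rewrite ge_min lexx.
have le2 : eps * (M + 1) <= e2.
  by rewrite -ler_pdivlMr// ge_min lexx orbT.
have [x gx] := approx_exists g eps0.
have {}h1 : cn (dual_inner (lift T f) g - f (ao_adj T x)) <= e / 2.
  by apply: (h1 eps x) => //; rewrite eps0.
have {}h2 : cn (dual_inner f (lift (ao_flip T) g) - f (ao_adj T x)) <= e / 2.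
  apply: (h2 (eps * (M + 1))); first by rewrite mulr_gt0.
  move=> y /=; rewrite ao_adjE'.
  apply: le_trans (gx (T y)) _; rewrite -mulrA ler_wpM2l ?(ltW eps0)//.
  apply: le_trans (TM y) _; rewrite ler_wpM2r ?sq_ge0//; lra.
have := cnD (dual_inner (lift T f) g - f (ao_adj T x)) (f (ao_adj T x) - dual_inner f (lift (ao_flip T) g)).
by rewrite subrKA (cn_distC (f _)); lra.
Qed.

End Lift.

Section DirectSum.
Context {R : realType} {T : choiceType} {W : lmodType R[i]} (G : T -> semi_inner W).

Definition finsupp_fun : {pred T -> W} :=
  [pred v : T -> W | `[< exists s : {fset T}, forall t, t \notin s -> v t = 0 >]].

Record dsum := DSum { dsum_fun :> T -> W; dsum_funP : dsum_fun \in finsupp_fun }.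

HB.instance Definition _ := [isSub for dsum_fun].
HB.instance Definition _ := [Choice of dsum by <:].

Implicit Types (v w : dsum).

Lemma dsum_ext v w : v =1 w -> v = w.
Proof. by move=> /funext/val_inj. Qed.

Lemma dsum_supp v : exists s : {fset T}, forall t, t \notin s -> v t = 0.
Proof. by have /asboolP := dsum_funP v. Qed.

Lemma finsupp_submod : submod_closed finsupp_fun.
Proof.
split=> [|k v w /asboolP[s vs] /asboolP[t wt]]; apply/asboolP.
  by exists fset0.
exists (s `|` t)%fset => i; rewrite inE negb_or => /andP[/vs vi /wt wi].
by rewrite !fctE vi wi scaler0 addr0.
Qed.

HB.instance Definition _ :=
  GRing.isSubmodClosed.Build R[i] (T -> W) finsupp_fun finsupp_submod.
HB.instance Definition _ := [SubChoice_isSubLmodule of dsum by <:].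

Lemma dsumDE v w t : (v + w) t = v t + w t. Proof. by []. Qed.
Lemma dsumZE k v t : (k *: v) t = k *: v t. Proof. by []. Qed.

Definition dsum_form v w : R[i] := \sum_(t \in [set: T]) G t (v t) (w t).

Lemma dsum_formE (s : {fset T}) v w : (forall t, t \notin s -> v t = 0) ->
  dsum_form v w = \sum_(t <- s) G t (v t) (w t).
Proof. by move=> vs; apply: fsbigTE => t /vs ->; rewrite si0l. Qed.

Lemma dsum_form_lin k v v' w :
  dsum_form (k *: v + v') w = k * dsum_form v w + dsum_form v' w.
Proof.
have [s vs] := dsum_supp v; have [s' vs'] := dsum_supp v'.
have h t : t \notin (s `|` s')%fset -> v t = 0 /\ v' t = 0.
  by rewrite inE negb_or => /andP[/vs vi /vs' wi].
rewrite !(@dsum_formE (s `|` s')%fset); try by move=> t /h[].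
  rewrite mulr_sumr -big_split /=; apply: eq_bigr => t _.
  exact: si_lin.
by move=> t /h[vt v't]; rewrite dsumDE dsumZE vt v't scaler0 addr0.
Qed.

Lemma dsum_form_sym v w : dsum_form w v = (dsum_form v w)^*.
Proof.
have [s vs] := dsum_supp v; have [s' vs'] := dsum_supp w.
have h t : t \notin (s `|` s')%fset -> v t = 0 /\ w t = 0.
  by rewrite inE negb_or => /andP[/vs vi /vs' wi].
rewrite !(@dsum_formE (s `|` s')%fset); try by move=> t /h[].
by rewrite rmorph_sum /=; apply: eq_bigr => t _; exact: si_sym.
Qed.

Lemma dsum_form_ge0 v : 0 <= dsum_form v v.
Proof.
have [s vs] := dsum_supp v; rewrite (dsum_formE _ vs).
by apply: sumr_ge0 => t _; exact: si_ge0.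
Qed.

Definition dsum_inner : semi_inner dsum :=
  SemiInner dsum_form_lin dsum_form_sym dsum_form_ge0.

Lemma dsum_sqE (s : {fset T}) v : (forall t, t \notin s -> v t = 0) ->
  sq dsum_inner v = \sum_(t <- s) sq (G t) (v t).
Proof.
move=> vs; apply: complexI; rewrite sqE /= (dsum_formE _ vs) rmorph_sum /=.
by apply: eq_bigr => t _; rewrite sqE.
Qed.

Lemma dsum_sq_eq0 v : (forall t, sq (G t) (v t) = 0) -> sq dsum_inner v = 0.
Proof.
move=> v0; have [s vs] := dsum_supp v; rewrite (dsum_sqE vs).
by rewrite big1.
Qed.

Lemma single_subproof (t0 : T) (x : W) : (fun t => if t == t0 then x else 0) \in finsupp_fun.
Proof. by apply/asboolP; exists [fset t0]%fset => t; rewrite inE => /negPf ->. Qed.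
Definition single t0 x := DSum (single_subproof t0 x).

Lemma dsum_form_single t0 x w : dsum_form (single t0 x) w = G t0 x (w t0).
Proof.
rewrite (@dsum_formE [fset t0]%fset); last by move=> t; rewrite inE /= => /negPf ->.
by rewrite big_seq_fset1 /= eqxx.
Qed.

Lemma wshift_subproof (p q : T -> T) (L : T -> W -> W) v :
  (forall t, q (p t) = t) -> (forall t, L t 0 = 0) ->
  (fun t => L t (v (p t))) \in finsupp_fun.
Proof.
move=> qp L0; have [s vs] := dsum_supp v; apply/asboolP.
exists [fset q t | t in s]%fset => t ts; rewrite vs ?L0//.
by apply: contra ts => pts; apply/imfsetP; exists (p t).
Qed.

Section WeightedShift.
Variables (p q : T -> T) (L L' : T -> W -> W) (M : R).
Hypotheses (qp : forall t, q (p t) = t) (pq : forall t, p (q t) = t).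
Hypothesis Llin : forall t k x y, L t (k *: x + y) = k *: L t x + L t y.
Hypothesis L'lin : forall t k x y, L' t (k *: x + y) = k *: L' t x + L' t y.
Hypothesis M0 : 0 <= M.
Hypothesis Lbound : forall t x, sq (G t) (L t x) <= M * sq (G (p t)) x.
Hypothesis L'bound : forall t x, sq (G t) (L' t x) <= M * sq (G (q t)) x.
Hypothesis LL' : forall t x y, G t (L t x) y = G (p t) x (L' (p t) y).

Let L0 (K : T -> W -> W) : (forall t k x y, K t (k *: x + y) = k *: K t x + K t y) ->
  forall t, K t 0 = 0.
Proof.
by move=> Klin t; have := Klin t (-1) 0 0; rewrite scaler0 addr0 scaleN1r addNr.
Qed.

Let shift_bound (a b : T -> T) (K : T -> W -> W) (Kv v : dsum) :
  (forall t, b (a t) = t) -> (forall t, a (b t) = t) ->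
  (forall t, K t 0 = 0) ->
  (forall t x, sq (G t) (K t x) <= M * sq (G (a t)) x) ->
  (forall t, Kv t = K t (v (a t))) -> sq dsum_inner Kv <= M * sq dsum_inner v.
Proof.
move=> ba ab K0 Kb KvE; have [s vs] := dsum_supp v.
rewrite (dsum_sqE vs) (@dsum_sqE [fset b t | t in s]%fset); last first.
  move=> t ts; rewrite KvE vs ?K0//.
  by apply: contra ts => pts; apply/imfsetP; exists (a t).
rewrite big_imfset /=; last by move=> t u _ _ /(congr1 a); rewrite !ab.
rewrite mulr_sumr; apply: ler_sum => t _.
by rewrite KvE ab; apply: le_trans (Kb _ _) _; rewrite ab.
Qed.

Definition wshift_fun v := DSum (wshift_subproof v qp (L0 Llin)).
Definition wshift_adj v := DSum (wshift_subproof v pq (L0 L'lin)).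

Lemma wshift_adjE v w : dsum_inner (wshift_fun v) w = dsum_inner v (wshift_adj w).
Proof.
have [s vs] := dsum_supp v.
rewrite /= (dsum_formE _ vs) (@dsum_formE [fset q t | t in s]%fset); last first.
  move=> t ts; rewrite /= vs ?(L0 Llin)//.
  by apply: contra ts => pts; apply/imfsetP; exists (p t).
rewrite big_imfset /=; last by move=> t u _ _ /(congr1 p); rewrite !pq.
by apply: eq_bigr => t _; rewrite LL' pq.
Qed.

(** One construction serves for [pi_op], where [p] and [q] are the identity, and for [U_op], where
    they shift d. *)
Definition wshift : adjop dsum_inner.
Proof.
refine (@AdjOp _ _ dsum_inner wshift_fun wshift_adj _ _ _ _ wshift_adjE).
- by move=> k v w; apply: dsum_ext => t; exact: Llin.
- by move=> k v w; apply: dsum_ext => t; exact: L'lin.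
- by exists M => // v; apply: (shift_bound qp pq (L0 Llin) Lbound).
- by exists M => // v; apply: (shift_bound pq qp (L0 L'lin) L'bound).
Defined.

End WeightedShift.

End DirectSum.

(** * The covariant representation *)

Section Construction.
Context {R : realType} {A : cstarAlgType R} (alpha : star_endomorphism A).
Variable J : set A.
Hypothesis hJ : closed_ideal J.
Implicit Types (a b c x y : A) (z d : int) (X Y Z : @bseq R A).

Definition endoz z a : A := if z is Posz m then iter m alpha a else 0.

Lemma endozP z k a b : endoz z (k *: a + b) = k *: endoz z a + endoz z b.
Proof.
case: z => m; last by rewrite /= scaler0 addr0.
by elim: m => //= m ->; rewrite linearP.
Qed.

Lemma endozM z a b : endoz z (a * b) = endoz z a * endoz z b.
Proof. by case: z => m; [elim: m => //= m ->; rewrite endoM|rewrite /= mulr0]. Qed.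

Lemma endoz_star z a : endoz z (star a) = star (endoz z a).
Proof. by case: z => m; [elim: m => //= m ->; rewrite endo_star|rewrite /= star0]. Qed.

Lemma endoz_nrm z a : nrm (endoz z a) <= nrm a.
Proof.
case: z => m; last by rewrite /= nrm0 nrm_ge0.
by elim: m => //= m; apply: le_trans; exact: endo_nrm.
Qed.

Definition pz z := endoz z 1.

Lemma pzMl z a : pz z * endoz z a = endoz z a.
Proof. by rewrite -endozM mul1r. Qed.
Lemma pzMr z a : endoz z a * pz z = endoz z a.
Proof. by rewrite -endozM mulr1. Qed.
Lemma pz_sa z : star (pz z) = pz z.
Proof. by rewrite -endoz_star star1. Qed.
Lemma pz_id z : pz z * pz z = pz z.
Proof. exact: pzMl. Qed.

(** The weights of [U]. They agree with [pz (z + 1)] except at z = -1, where [pz 0] is 1; this one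
    value is the source of the defect of U^*U. *)
Definition uz z : A := if z is Posz m then endoz m.+1 1 else 0.

Lemma uz_sa z : star (uz z) = uz z.
Proof. by case: z => m; [rewrite /uz -/(pz m.+1) pz_sa|rewrite /= star0]. Qed.

Lemma uz_pos (m : nat) : uz m = endoz m (alpha 1).
Proof. by rewrite /uz /= -iterSr. Qed.

Lemma uz_id z : uz z * uz z = uz z.
Proof. by case: z => m; [exact: (pz_id m.+1)|rewrite /= mulr0]. Qed.
Lemma pz_uz z : pz z * uz z = uz z.
Proof. by case: z => m; [rewrite uz_pos pzMl|rewrite /= mulr0]. Qed.
Lemma uz_pz z : uz z * pz z = uz z.
Proof. by case: z => m; [rewrite uz_pos pzMr|rewrite /= mulr0]. Qed.
Lemma uzS z : uz z = if 0 <= z then pz (z + 1) else 0.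
Proof. by case: z => m //=; rewrite addn1. Qed.
Lemma pzS_uz z : pz (z + 1) * uz z = uz z.
Proof. by rewrite uzS; case: ifP; rewrite ?pz_id ?mulr0. Qed.
Lemma uz_pzS z : uz z * pz (z + 1) = uz z.
Proof. by rewrite uzS; case: ifP; rewrite ?pz_id ?mul0r. Qed.

(** The entrywise form of the relation that [U] has to implement. At z = -1 the weight 0 is what
    makes it hold. *)
Lemma uz_endoz z b : uz z * endoz (z + 1) b * uz z = endoz z (alpha b).
Proof.
case: z => m; last by rewrite /= mulr0.
have -> : Posz m + 1 = m.+1 by rewrite (addrC _ 1) -intS.
by rewrite /uz -/(pz m.+1) pzMl pzMr /= -iterSr.
Qed.

Lemma brho_subproof d a : (fun n : nat => endoz (n%:Z + d) a) \in bounded_seq.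
Proof. by apply/asboolP; exists (nrm a) => n; exact: endoz_nrm. Qed.
Definition brho d a := BSeq (brho_subproof d a).

Lemma brhoE d a n : brho d a n = endoz (n%:Z + d) a. Proof. by []. Qed.

Lemma bu_subproof d : (fun n : nat => uz (n%:Z + d)) \in bounded_seq.
Proof.
have uz_nrm z : nrm (uz z) <= nrm (1 : A).
  by case: z => m; [exact: (endoz_nrm m.+1)|rewrite /= nrm0 nrm_ge0].
by apply/asboolP; exists (nrm (1 : A)) => n; exact: uz_nrm.
Qed.
Definition bu d := BSeq (bu_subproof d).

Lemma buE d n : bu d n = uz (n%:Z + d). Proof. by []. Qed.

(* The zero functional is the default, so that every function is an index. *)
Definition pf (Phi : @bseq R A -> R[i]) : bseq -> R[i] :=
  if `[< pos_functional J Phi >] then Phi else fun=> 0.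

Lemma pfP Phi : pos_functional J (pf Phi).
Proof.
rewrite /pf; case: asboolP => [//|_]; split => //.
- by move=> k X Y; rewrite mulr0 addr0.
- by move=> X; rewrite conjC0.
Qed.

Lemma pfE Phi : pos_functional J Phi -> pf Phi = Phi.
Proof. by rewrite /pf => /asboolP ->. Qed.

Section Slot.
Variables (Phi : @bseq R A -> R[i]) (d : int).

(** The factor [brho d 1] identifies vectors that differ outside the range of this projection, on
    which all [brho d a] act. *)
Definition slot_form X Y :=
  pf Phi (bmul (bstar (bmul (brho d 1) Y)) (bmul (brho d 1) X)).

Lemma slot_lin k X Y Z : slot_form (k *: X + Y) Z = k * slot_form X Z + slot_form Y Z.
Proof.
rewrite /slot_form -(pf_linear (pfP Phi)); congr (pf Phi _).
apply: bseq_ext => n.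
by rewrite !(bseqD, bseqZ, bmulE, bstarE) mulrDr mulrDr -!cstar_scalerAr.
Qed.

Lemma slot_sym X Y : slot_form Y X = (slot_form X Y)^*.
Proof.
rewrite /slot_form -(pf_star (pfP Phi)); congr (pf Phi _).
by apply: bseq_ext => n /=; rewrite [RHS]starM starK.
Qed.

Lemma slot_ge0 X : 0 <= slot_form X X.
Proof. exact: (pf_ge0 (pfP Phi)). Qed.

Definition slot : semi_inner bseq := SemiInner slot_lin slot_sym slot_ge0.

End Slot.

(** The remainder in an operator inequality is given as an explicit square, so that only linearity
    and positivity of the functional are needed. *)
Lemma pf_le Phi r X Y Z :
  (forall n, r%:C *: (star (X n) * X n) = star (Y n) * Y n + star (Z n) * Z n) ->
  complex.Re (pf Phi (bmul (bstar Y) Y)) <= r * complex.Re (pf Phi (bmul (bstar X) X)).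
Proof.
move=> E; have := pf_linear (pfP Phi) r%:C (bmul (bstar X) X) 0.
rewrite addr0 (pos_functional0 (pfP Phi)) addr0.
have -> : r%:C *: bmul (bstar X) X = 1 *: bmul (bstar Y) Y + bmul (bstar Z) Z.
  by apply: bseq_ext => n; rewrite scale1r bseqD bseqZ; exact: E.
rewrite (pf_linear (pfP Phi)) mul1r => /(congr1 (@complex.Re R)).
rewrite raddfD /=.
have -> (w : R[i]) : complex.Re (r%:C * w) = r * complex.Re w.
  by case: w => u v /=; rewrite mul0r subr0.
move=> <-; rewrite lerDl.
by have := pf_ge0 (pfP Phi) Z; rewrite lecE => /andP[_].
Qed.

Lemma slot_sq Phi d X : sq (slot Phi d) X =
  complex.Re (pf Phi (bmul (bstar (bmul (brho d 1) X)) (bmul (brho d 1) X))).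
Proof. by []. Qed.

(** The remainder comes from the root c of |a|^2 - [star a * a]. *)
Lemma slot_brho_bound Phi d a X :
  sq (slot Phi d) (bmul (brho d a) X) <= nrm a ^+ 2 * sq (slot Phi d) X.
Proof.
have [c cs cE] := pos_nrm_sqr a.
rewrite !slot_sq; apply: (@pf_le _ _ _ _ (bmul (brho d c) X)) => n /=.
set z := (n%:Z + d); set x := X n; rewrite -/(pz z) !starM -!endoz_star star1.
rewrite -/(pz z) cs.
have -> : star x * pz z * (pz z * x) = star x * pz z * x by rewrite -mulrA (mulrA (pz z)) pz_id !mulrA.
have -> : star x * endoz z (star a) * pz z * (pz z * (endoz z a * x)) =
   star x * endoz z (star a * a) * x.
  by rewrite (mulrA (pz z)) pzMl -(mulrA (star x)) pzMr endozM !mulrA.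
have -> : star x * endoz z c * (endoz z c * x) = star x * endoz z (c * c) * x.
  by rewrite endozM !mulrA.
rewrite -mulrDl -mulrDr -[endoz z (star a * a)]scale1r -endozP.
have -> : 1 *: (star a * a) + c * c = (nrm a ^+ 2)%:C *: (1 : A) + 0.
  by rewrite scale1r -cE addrCA subrr.
rewrite endozP -scMl -scMr; congr (_ * _ * _).
suff -> : endoz z 0 = 0 by rewrite addr0.
by have := endozP z (-1) 0 0; rewrite scaler0 addr0 scaleN1r addNr.
Qed.

(** [uz z] is a projection below both [pz z] and [pz (z + 1)]; the remainder is a difference of
    projections, here and for the adjoint. *)
Lemma slot_bu_bound Phi d X : sq (slot Phi d) (bmul (bu d) X) <= 1 * sq (slot Phi (d + 1)) X.
Proof.
rewrite !slot_sq; apply: (@pf_le _ _ _ _ (bmul (brho (d + 1) 1 - bu d) X)) => n.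
rewrite !(bmulE, bstarE, bseqD, bseqN) /= addrA; set z := (n%:Z + d); set x := X n.
rewrite -/(pz z) -/(pz (z + 1)) !starM starB !pz_sa uz_sa scale1r.
have P := pz_id (z + 1); have Q := pz_uz z; have Q' := uz_pz z.
have S := pzS_uz z; have S' := uz_pzS z; have U := uz_id z.
have -> : star x * pz (z + 1) * (pz (z + 1) * x) = star x * (pz (z + 1) * pz (z + 1)) * x.
  by rewrite !mulrA.
have -> : star x * uz z * pz z * (pz z * (uz z * x)) = star x * (uz z * pz z * (pz z * uz z)) * x.
  by rewrite !mulrA.
have -> : star x * (pz (z + 1) - uz z) * ((pz (z + 1) - uz z) * x) =
   star x * ((pz (z + 1) - uz z) * (pz (z + 1) - uz z)) * x by rewrite !mulrA.
rewrite -mulrDl -mulrDr; congr (_ * _ * _).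
rewrite mulrBl !mulrBr P Q Q' S S' U subrr subr0.
by rewrite [RHS]addrC subrK.
Qed.

Lemma slot_bu_adj_bound Phi d X :
  sq (slot Phi d) (bmul (bu (d - 1)) X) <= 1 * sq (slot Phi (d - 1)) X.
Proof.
rewrite !slot_sq; apply: (@pf_le _ _ _ _ (bmul (brho (d - 1) 1 - bu (d - 1)) X)) => n.
rewrite !(bmulE, bstarE, bseqD, bseqN) /=.
have -> : n%:Z + d = (n%:Z + (d - 1)) + 1 by rewrite addrA subrK.
set z := (n%:Z + (d - 1)); set x := X n.
rewrite -/(pz z) -/(pz (z + 1)) !starM starB !pz_sa uz_sa scale1r.
have P := pz_id z; have Q := pz_uz z; have Q' := uz_pz z.
have S := pzS_uz z; have S' := uz_pzS z; have U := uz_id z.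
have -> : star x * pz z * (pz z * x) = star x * (pz z * pz z) * x by rewrite !mulrA.
have -> : star x * uz z * pz (z + 1) * (pz (z + 1) * (uz z * x)) =
  star x * (uz z * pz (z + 1) * (pz (z + 1) * uz z)) * x by rewrite !mulrA.
have -> : star x * (pz z - uz z) * ((pz z - uz z) * x) =
   star x * ((pz z - uz z) * (pz z - uz z)) * x by rewrite !mulrA.
rewrite -mulrDl -mulrDr; congr (_ * _ * _).
rewrite mulrBl !mulrBr P Q Q' S S' U subrr subr0.
by rewrite [RHS]addrC subrK.
Qed.

Lemma slot_brho_adj Phi d a X Y :
  slot Phi d (bmul (brho d a) X) Y = slot Phi d X (bmul (brho d (star a)) Y).
Proof.
congr (pf Phi _); apply: bseq_ext => n /=.
set z := n%:Z + d; rewrite -/(pz z) !starM endoz_star starK pz_sa -!mulrA.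
by rewrite (mulrA (pz z) (endoz z a)) pzMl (mulrA (pz z) (endoz z a)) pzMl (mulrA (endoz z a)) pzMr
  (mulrA (endoz z a)) pzMr.
Qed.

Lemma slot_bu_adj Phi d X Y :
  slot Phi d (bmul (bu d) X) Y = slot Phi (d + 1) X (bmul (bu (d + 1 - 1)) Y).
Proof.
congr (pf Phi _); apply: bseq_ext => n /=; rewrite addrK addrA.
set z := n%:Z + d; rewrite -/(pz z) -/(pz (z + 1)) !starM uz_sa !pz_sa -!mulrA.
rewrite (mulrA (pz z) (uz z)) pz_uz (mulrA (pz z) (uz z)) pz_uz.
by rewrite (mulrA (uz z) (pz _)) uz_pzS (mulrA (uz z) (pz _)) uz_pzS.
Qed.

Definition index := ((@bseq R A -> R[i]) * int)%type.
Definition idx_slot (t : index) : semi_inner bseq := slot t.1 t.2.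
Definition idx_succ (t : index) : index := (t.1, t.2 + 1).
Definition idx_pred (t : index) : index := (t.1, t.2 - 1).

Lemma idx_succK t : idx_pred (idx_succ t) = t.
Proof. by case: t => P d; rewrite /idx_pred /= addrK. Qed.
Lemma idx_predK t : idx_succ (idx_pred t) = t.
Proof. by case: t => P d; rewrite /idx_succ /= subrK. Qed.

Lemma bmul_lin (W : bseq) k X Y : bmul W (k *: X + Y) = k *: bmul W X + bmul W Y.
Proof.
by apply: bseq_ext => n; rewrite !(bmulE, bseqD, bseqZ) mulrDr cstar_scalerAr.
Qed.

Local Notation V := (@dsum R index (@bseq R A)).
Local Notation F := (dsum_inner idx_slot).
Local Notation H := (dual F).

Definition pi_op a : adjop F.
Proof.
apply: (@wshift _ _ _ idx_slot id id (fun t => bmul (brho t.2 a))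
  (fun t => bmul (brho t.2 (star a))) (nrm a ^+ 2)) => //.
- by move=> t; exact: bmul_lin.
- by move=> t; exact: bmul_lin.
- by rewrite exprn_ge0 ?nrm_ge0.
- by move=> t X; exact: slot_brho_bound.
- by move=> t X; rewrite -(nrm_star a); exact: slot_brho_bound.
- by move=> t X Y; exact: slot_brho_adj.
Defined.

Definition U_op : adjop F.
Proof.
apply: (@wshift _ _ _ idx_slot idx_succ idx_pred (fun t => bmul (bu t.2))
  (fun t => bmul (bu (t.2 - 1))) 1 idx_succK idx_predK).
- by move=> t; exact: bmul_lin.
- by move=> t; exact: bmul_lin.
- exact: ler01.
- by move=> t X; exact: slot_bu_bound.
- by move=> t X; exact: slot_bu_adj_bound.
- by move=> t X Y; exact: slot_bu_adj.
Defined.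

Lemma pi_opE a (v : V) t : pi_op a v t = bmul (brho t.2 a) (v t). Proof. by []. Qed.
Lemma pi_op_adjE a (v : V) : ao_adj (pi_op a) v = pi_op (star a) v.
Proof. by apply: dsum_ext => t. Qed.
Lemma U_opE (v : V) t : U_op v t = bmul (bu t.2) (v (idx_succ t)). Proof. by []. Qed.
Lemma U_op_adjE (v : V) t : ao_adj U_op v t = bmul (bu (t.2 - 1)) (v (idx_pred t)).
Proof. by []. Qed.

Lemma pi_op_lin k a b (v : V) : pi_op (k *: a + b) v = k *: pi_op a v + pi_op b v.
Proof.
apply: dsum_ext => t; rewrite dsumDE dsumZE !pi_opE; apply: bseq_ext => n.
by rewrite !(bmulE, bseqD, bseqZ) /= endozP mulrDl cstar_scalerAl.
Qed.

Lemma pi_opM a b (v : V) : pi_op (a * b) v = pi_op a (pi_op b v).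
Proof.
apply: dsum_ext => t; rewrite !pi_opE; apply: bseq_ext => n /=.
by rewrite endozM mulrA.
Qed.

Lemma U_pi_U a (v : V) : U_op (pi_op a (ao_adj U_op v)) = pi_op (alpha a) v.
Proof.
apply: dsum_ext => t; rewrite U_opE !pi_opE U_op_adjE idx_succK.
apply: bseq_ext => n /=; rewrite addrK addrA !mulrA -uz_endoz.
by [].
Qed.

Definition pi_lift a : bop H := lift (pi_op a).

Lemma pi_liftE a (f : H) v : pi_lift a f v = f (pi_op (star a) v).
Proof. by rewrite /pi_lift liftE pi_op_adjE. Qed.

Lemma pi_lift_linear : linear pi_lift.
Proof.
move=> k a b; apply: bop_ext => f; apply: dual_ext => v.
rewrite pi_liftE starD starZ pi_op_lin dual_antilinear conjCK.
by rewrite bopDE bopZE dualDE dualZE !pi_liftE.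
Qed.

HB.instance Definition _ := GRing.isLinear.Build R[i] A (bop H) _ pi_lift pi_lift_linear.

(** On [V] itself [pi_op 1] is not the identity; it moves vectors by null vectors, which every
    bounded functional kills. *)
Lemma pi_lift1 : pi_lift 1 = 1.
Proof.
apply: bop_ext => f; apply: dual_ext => v; rewrite bop1E pi_liftE star1.
apply/eqP; rewrite -subr_eq0 -dualB; apply/eqP/dual_null/dsum_sq_eq0 => t.
rewrite /idx_slot slot_sq.
suff -> : bmul (brho t.2 1) ((pi_op 1 v - v) t) = 0.
  have -> : bmul (bstar 0) 0 = 0 :> @bseq R A by apply: bseq_ext => n /=; rewrite mulr0.
  by rewrite (pos_functional0 (pfP t.1)).
apply: bseq_ext => n; rewrite -[(pi_op 1 v - v) t]/(pi_op 1 v t - v t) pi_opE.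
rewrite !(bmulE, bseqD, bseqN) /= -/(pz _).
by rewrite mulrBr mulrA pz_id subrr.
Qed.

Lemma pi_liftM : {morph pi_lift : a b / a * b}.
Proof.
move=> a b; apply: bop_ext => f; apply: dual_ext => v.
by rewrite bopME !pi_liftE starM pi_opM.
Qed.

Lemma pi_lift_star a : pi_lift (star a) = adjoint (pi_lift a).
Proof.
rewrite /pi_lift adjoint_lift; apply: bop_ext => f; apply: dual_ext => v.
by rewrite !liftE pi_op_adjE starK.
Qed.

Lemma lift_implements a :
  lift U_op * pi_lift a * adjoint (lift U_op) = pi_lift (alpha a).
Proof.
rewrite adjoint_lift; apply: bop_ext => f; apply: dual_ext => v.
rewrite !bopME liftE pi_liftE liftE pi_liftE -endo_star -U_pi_U.
by [].
Qed.

Definition covariant_rep : representation alpha H :=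
  @Representation R A alpha H pi_lift (lift U_op) pi_lift1 pi_liftM pi_lift_star
    lift_implements.

End Construction.

(** * Faithfulness and covariance of the representation *)

Section Covariance.
Context {R : realType} {A : cstarAlgType R} (alpha : star_endomorphism A).
Variable J : set A.
Hypothesis hJ : closed_ideal J.
Hypothesis injJ : forall b, alpha b = 0 -> J b -> b = 0.
Implicit Types (a b c x y : A) (z d : int) (X Y Z : @bseq R A).

Local Notation V := (@dsum R (@index R A) (@bseq R A)).
Local Notation F := (dsum_inner (idx_slot alpha J)).
Local Notation H := (dual F).


Lemma ideal_of_delta_null n b : (forall Phi, pos_functional J Phi ->
  Phi (bdelta n (star b * b)) = 0) -> J b.
Proof.
move=> hPhi; apply: (ideal_of_approx hJ) => s s0.
have [|Z [_ ZJ Zs] Zp] := separating_functional hJ _ hPhi s0.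
  by move=> m /=; case: ifP; rewrite ?star0 ?sa_starM.
by exists (Z n); split => //; have := Zp n; rewrite /= eqxx.
Qed.

Lemma nrm_le_endoz c : (forall m : nat, J (endoz alpha m c)) ->
  forall m : nat, nrm c <= nrm (endoz alpha m c).
Proof.
move=> Jc; elim=> // m ih; apply: le_trans ih _.
exact: (endo_isometric hJ injJ (Jc m)).
Qed.

Lemma eq0_of_orbit_null c : (forall Phi, pos_functional J Phi ->
  Phi (brho alpha 0 (star c * c)) = 0) -> c = 0.
Proof.
move=> hPhi.
have E n : brho alpha 0 (star c * c) n = star (endoz alpha n c) * endoz alpha n c.
  by rewrite -[LHS]/(endoz alpha (n%:Z + 0) _) addr0 endozM endoz_star.
have hs n : star (brho alpha 0 (star c * c) n) = brho alpha 0 (star c * c) n.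
  by rewrite E sa_starM.
have Jc (m : nat) : J (endoz alpha m c).
  apply: (ideal_of_approx hJ) => s s0.
  have [Z [_ ZJ Zs] Zp] := separating_functional hJ hs hPhi s0.
  by exists (Z m); split => //; rewrite -E.
have sm s : 0 < s -> nrm c ^+ 2 <= s.
  (* At an index N beyond the support of [Z] the correction is gone and |alpha^N(c)|^2 <= s
     remains. *)
  move=> s0; have [Z [[N Z0] ZJ Zs] Zp] := separating_functional hJ hs hPhi s0.
  apply: (@le_trans _ _ (nrm (endoz alpha N c) ^+ 2)).
    by rewrite ler_pXn2r ?nnegrE ?nrm_ge0// nrm_le_endoz.
  apply: nrm_sqr_le_of_pos; first exact: ltW.
  by have := Zp N; rewrite Z0// addr0 E.
apply: nrm0_eq0; apply/eqP; rewrite -sqrf_eq0; apply/eqP/le_anti.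
rewrite exprn_ge0 ?nrm_ge0// andbT.
by apply/ler_addgt0Pr => e /sm; rewrite add0r.
Qed.

(** The GNS cyclic vector of [Phi] in the summand d = 0: pairing with it evaluates [Phi]. *)
Definition slot_vector (Phi : @bseq R A -> R[i]) : H := iota F (single (Phi, 0%Z : int) (bone : @bseq R A) : V).

Lemma slot_vectorE Phi (v : V) : pos_functional J Phi ->
  slot_vector Phi v = Phi (bmul (bstar (bmul (brho alpha 0 1) (v (Phi, 0)))) (bmul (brho alpha 0 1) bone)).
Proof.
by move=> hPhi; rewrite /= dsum_form_single /= /slot_form pfE.
Qed.

Lemma covariant_rep_faithful : faithful (covariant_rep alpha J).
Proof.
move=> a b /= ab; apply/eqP; rewrite -subr_eq0; apply/eqP; set c := a - b.
have c0 : pi_lift alpha J c = 0 by rewrite /c linearB /= ab subrr.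
apply: eq0_of_orbit_null => Phi hPhi.
have : pi_lift alpha J c (slot_vector Phi) (single (Phi, 0) (brho alpha 0 c)) = 0.
  by rewrite c0.
rewrite pi_liftE slot_vectorE// pi_opE /= eqxx => <-; congr (Phi _).
apply: bseq_ext => n; rewrite !(bmulE, bstarE, brhoE, boneE) mulr1.
by rewrite -!endozM -endoz_star -endozM mul1r mulr1 sa_starM.
Qed.

(** Entry n of summand d is multiplied under U^*U by [pz (n + d)] if n + d > 0 and by 0 if n + d =
    0, so the difference lives in one entry y, with [star y * y] in [J]. The hypothesis is on
    [star a] because [pi_lift] of an element precomposes with [pi_op] of its adjoint. *)
Lemma defect_null (f : H) a (v : V) : J (star a) ->
  f (pi_op alpha J a (ao_adj (U_op alpha J) (U_op alpha J v))) = f (pi_op alpha J a v).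
Proof.
move=> Ja; apply/eqP; rewrite -subr_eq0 -dualB; apply/eqP/dual_null/dsum_sq_eq0.
move=> [Phi d]; rewrite /idx_slot slot_sq /=.
set w := (X in bmul (brho alpha d 1) X).
have wE n : w n = - (if n%:Z + d == 0 then a * v (Phi, d) n else 0).
  rewrite /w -[X in bseq_fun X]/(pi_op alpha J a (ao_adj (U_op alpha J) (U_op alpha J v)) (Phi, d)
     - pi_op alpha J a v (Phi, d)).
  rewrite !pi_opE U_op_adjE U_opE idx_predK !(bmulE, bseqD, bseqN, brhoE, buE) /=.
  rewrite addrA; set z := n%:Z + d; set x := v _ n.
  rewrite (mulrA (uz _ _)) uz_id mulrA; case: z => [[|m]|m].
  - by rewrite mulr0 mul0r sub0r.
  - have -> : Posz m.+1 - 1 = m by rewrite intS addrC addKr.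
    by rewrite /uz -/(pz alpha m.+1) pzMr subrr oppr0.
  - by rewrite /= !mul0r subrr oppr0.
(* For d <= 0 the defective entry is n = -d; for d > 0 there is none. *)
pose m := `|d|%N; pose y := a * v (Phi, d) m.
have Jy : J (star y * y) by rewrite /y starM; apply: (idealMr hJ); apply: (idealMl hJ).
have -> : bmul (bstar (bmul (brho alpha d 1) w)) (bmul (brho alpha d 1) w) =
    if d <= 0 then bdelta m (star y * y) else 0.
  apply: bseq_ext => n; rewrite !(bmulE, bstarE, brhoE) wE.
  have [nd0|nd0] := eqVneq (n%:Z + d) 0.
    have -> : d <= 0 by lia.
    have nm : n = m by rewrite /m; lia.
    by rewrite bdeltaE nm eqxx -nm nd0 /= !mul1r starN mulrNN -/y nm.
  rewrite oppr0 !mulr0; case: ifP => // d0.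
  by rewrite bdeltaE; case: eqP => // nm; exfalso; move: nd0; rewrite nm /m; lia.
case: ifP => _; last by rewrite (pos_functional0 (pfP J Phi)).
by rewrite (pf_delta (pfP J Phi)) ?sa_starM.
Qed.

Lemma covariant_rep_covariant : covariant J (covariant_rep alpha J).
Proof.
have EU a (f : H) (v : V) :
    (adjoint (lift (U_op alpha J)) * lift (U_op alpha J) * pi_lift alpha J a) f v =
    f (pi_op alpha J (star a) (ao_adj (U_op alpha J) (U_op alpha J v))).
  by rewrite adjoint_lift -pi_liftE.
rewrite /covariant; apply/seteqP; split => a /=.
  move=> Ja; apply: bop_ext => f; apply: dual_ext => v.
  by rewrite EU pi_liftE defect_null// starK.
move=> E; apply: (@ideal_of_delta_null 0%N) => Phi hPhi.
(* The test vector sits in entry 0 of summand 0, which U^*U annihilates; the other side of the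
   covariance equation evaluates [Phi] at entry [star a * a]. *)
have PhiX := EU a (slot_vector Phi) (single (Phi, 0) (bdelta 0 a)).
rewrite E pi_liftE !slot_vectorE// !pi_opE U_op_adjE U_opE idx_predK /= eqxx in PhiX.
set X := (X in Phi X = _) in PhiX; set Y := (X in _ = Phi X) in PhiX.
have <- : X = bdelta 0 (star a * a).
  apply: bseq_ext => n; rewrite /X !(bmulE, bstarE, brhoE, boneE, bdeltaE) mulr1.
  case: eqP => [->|_]; last by rewrite !mulr0 star0 mul0r.
  by rewrite /= !mul1r mulr1 starM starK.
rewrite PhiX; have -> : Y = 0.
  apply: bseq_ext => n; rewrite /Y !(bmulE, bstarE, brhoE, boneE, bdeltaE, buE).
  case: eqP => [->|_]; last by rewrite !mulr0 star0 mul0r.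
  by rewrite /= !(mul0r, mulr0) star0 mul0r.
exact: pos_functional0 hPhi.
Qed.

End Covariance.

Theorem theorem1p11 (R : realType) (A : cstarAlgType R)
    (alpha : star_endomorphism A) (J : set A) (hJ : closed_ideal J) :
  (exists (H : hilbertType R) (r : representation alpha H),
    faithful r /\ covariant J r) <->
  [set a | alpha a = 0] `&` J = [set 0].
Proof.
split=> [[H [r [rinj rcov]]]|kerJ]; last first.
  have injJ b : alpha b = 0 -> J b -> b = 0.
    by move=> ab Jb; have : ([set a | alpha a = 0] `&` J) b by []; rewrite kerJ.
  exists (dual (dsum_inner (idx_slot alpha J))), (covariant_rep alpha J).
  by split; [exact: covariant_rep_faithful|exact: covariant_rep_covariant].
apply/seteqP; split => a /=; last first.
  by move=> ->; split; [exact: linear0|exact: ideal0].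
(* Passing to [star a * a] gives a self-adjoint element of [J], to which adjoints can be applied. *)
move=> [aa Ja]; apply: nrm0_eq0; apply/eqP; rewrite -sqrf_eq0 -nrm_star_mul.
suff -> : star a * a = 0 by rewrite nrm0.
apply: rinj; rewrite linear0.
pose Q := adjoint (rep_U r) * rep_U r.
have adjM (S T : bop H) : adjoint (S * T) = adjoint T * adjoint S.
  by apply: adjoint_unique => x y; rewrite !bopME !adjointP.
have adjK (S : bop H) : adjoint (adjoint S) = S.
  apply: adjoint_unique => x y.
  by rewrite innerC -adjointP -innerC.
have Jaa : J (star a * a) by apply: idealMl.
have QJ b : J b -> Q * r b = r b by rewrite {1}rcov.
(* With Q = U^*U this product is U^* r(alpha a) U. Covariance then removes the left factor Q, but
   not the right one. *)
have Qa0 : Q * r a * Q = 0.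
  have := rep_implements r a; rewrite aa linear0 => h.
  have -> : Q * r a * Q = adjoint (rep_U r) * (rep_U r * r a * adjoint (rep_U r)) * rep_U r.
    by rewrite /Q !mulrA.
  by rewrite h mulr0 mul0r.
rewrite (QJ a Ja) in Qa0.
have Qs : adjoint Q = Q by rewrite /Q adjM adjK.
have h1 : r (star a * a) * Q = 0 by rewrite rep_piM -mulrA Qa0 mulr0.
have h2 : adjoint (r (star a * a)) = r (star a * a).
  by rewrite -rep_pi_star starM starK.
(* Taking adjoints moves Q to the left, where covariance absorbs it. *)
have h3 : adjoint (r (star a * a) * Q) = r (star a * a) by rewrite adjM h2 Qs QJ.
rewrite -h3 h1; apply: adjoint_unique => x y.
by rewrite linear0l linear0r.
Qed.
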